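(* Let $2\le n<\infty$, let $\mathcal O_n$ be the Cuntz algebra with canonical generating isometries $\mathfrak s_1,\dots,\mathfrak s_n$ (so $\sum_i\mathfrak s_i\mathfrak s_i^*=1$), and let $\mathfrak A_n$ be the non-commutative disk algebra, the norm-closed unital (non-self-adjoint) subalgebra of $\mathcal O_n$ generated by $\mathfrak s_1,\dots,\mathfrak s_n$. If $\alpha$ is a unital $*$-endomorphism of $\mathcal O_n$ with $\alpha(\mathfrak A_n)\subseteq\mathfrak A_n$, then $\alpha$ is a $*$-automorphism of $\mathcal O_n$ with $\alpha(\mathfrak A_n)=\mathfrak A_n$. *)

(* Defs.v *)
From mathcomp Require Import all_boot all_algebra.
From mathcomp Require Export complex.
From mathcomp Require Export reals.
Set Implicit Arguments. Unset Strict Implicit. Unset Printing Implicit Defensive.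
Import GRing.Theory Num.Theory.
Local Open Scope ring_scope.

Section CStar.
Variables (R : realType) (A : algType R[i]).

Record is_cstar_algebra (star : A -> A) (nrm : A -> R) : Prop := {
  cs_nrm_ge0 : forall x, 0 <= nrm x;
  cs_nrm_eq0 : forall x, nrm x = 0 -> x = 0;
  cs_nrm_triangle : forall x y, nrm (x + y) <= nrm x + nrm y;
  cs_nrm_scale : forall (c : R[i]) x, ((nrm (c *: x))%:C = `|c| * (nrm x)%:C)%C;
  cs_nrm_submult : forall x y, nrm (x * y) <= nrm x * nrm y;
  cs_complete : forall u : nat -> A,
      (forall e : R, 0 < e -> exists N, forall m k, (N <= m)%N -> (N <= k)%N ->
          nrm (u m - u k) < e) ->
      exists l, forall e : R, 0 < e -> exists N, forall m, (N <= m)%N ->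
          nrm (u m - l) < e;
  cs_star_add : forall x y, star (x + y) = star x + star y;
  cs_star_scale : forall (c : R[i]) x, star (c *: x) = c^* *: star x;
  cs_star_mul : forall x y, star (x * y) = star y * star x;
  cs_star_invol : forall x, star (star x) = x;
  cs_cstar_identity : forall x, nrm (star x * x) = nrm x ^+ 2
}.

Definition nclosure (nrm : A -> R) (S : A -> Prop) : A -> Prop :=
  fun x => forall e : R, 0 < e -> exists y, S y /\ nrm (x - y) < e.

Inductive star_poly (star : A -> A) (I : Type) (g : I -> A) : A -> Prop :=
| sp_gen i : star_poly star g (g i)
| sp_one : star_poly star g 1
| sp_add x y : star_poly star g x -> star_poly star g y -> star_poly star g (x + y)
| sp_scale (c : R[i]) x : star_poly star g x -> star_poly star g (c *: x)
| sp_mul x y : star_poly star g x -> star_poly star g y -> star_poly star g (x * y)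
| sp_star x : star_poly star g x -> star_poly star g (star x).

Inductive alg_poly (I : Type) (g : I -> A) : A -> Prop :=
| ap_gen i : alg_poly g (g i)
| ap_one : alg_poly g 1
| ap_add x y : alg_poly g x -> alg_poly g y -> alg_poly g (x + y)
| ap_scale (c : R[i]) x : alg_poly g x -> alg_poly g (c *: x)
| ap_mul x y : alg_poly g x -> alg_poly g y -> alg_poly g (x * y).

(* A is the Cuntz algebra O_n with canonical generators s : the C*-algebra
   generated by n isometries s_i with sum_i s_i s_i^* = 1 (Cuntz's definition;
   it is unique up to isomorphism by Cuntz's theorem). *)
Definition is_cuntz_algebra (n : nat) (star : A -> A) (nrm : A -> R)
    (s : 'I_n -> A) : Prop :=
  [/\ is_cstar_algebra star nrm,
      (forall i, star (s i) * s i = 1),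
      \sum_(i < n) s i * star (s i) = 1
    & (forall x, nclosure nrm (star_poly star s) x)].

Definition disk_algebra (n : nat) (nrm : A -> R) (s : 'I_n -> A) : A -> Prop :=
  nclosure nrm (alg_poly s).

Definition unital_star_endo (star : A -> A) (alpha : A -> A) : Prop :=
  [/\ (forall x y, alpha (x + y) = alpha x + alpha y),
      (forall (c : R[i]) x, alpha (c *: x) = c *: alpha x),
      (forall x y, alpha (x * y) = alpha x * alpha y),
      alpha 1 = 1
    & (forall x, alpha (star x) = star (alpha x))].

(* *-automorphism: bijective *-endomorphism (its inverse is then automatically
   a *-endomorphism) *)
Definition star_automorphism (star : A -> A) (alpha : A -> A) : Prop :=
  unital_star_endo star alpha /\ bijective alpha.

End CStar.

(* Main.v *)
Require Import Defs.
From mathcomp Require Import all_boot all_order all_algebra.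
From mathcomp Require Import boolp classical_sets reals zify ring lra.

(* Put v_j = alpha(s_j). Only three properties of O_n enter: the C*-norm of the *-algebra
   generated by Cuntz isometries is determined by the algebra, so that alpha is isometric; the
   vacuum state phi(s_u^* s_w) = [u = w] turns the disk algebra A_n into a pre-Hilbert space
   with orthonormal basis the words, faithfully; and 1 = sum_j v_j v_j^*.

   Let P be the orthogonal projection onto the complement of sum_j v_j A_n, so P s_w is the
   residual of s_w. Right multiplications commute with the v_j, which gives the recursion
   P s_{wi} = (P s_w) s_i - sum_j conj(v_j(wi)) v_j, and hence
   |P s_{wi}|^2 = |P s_w|^2 - sum_j |v_j(wi)|^2. Summing over words, the partial traces S_m of
   P satisfy S_{m+1} - 1 >= n (S_m - 1), while 1 = sum_j v_j v_j^* forces |P s_w| -> 0 as the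
   length of w grows. As n >= 2 these are compatible only if the trace of P is at most 1.
   So P has rank one, and P s_i is a multiple of g = P 1 = 1 - sum_j conj(v_j([])) v_j. This is a
   relation g s_i = c g + sum_j d_j v_j with g invertible in the closed algebra generated by the
   v_j, so every s_i lies in alpha(A_n). *)

Set Implicit Arguments. Unset Strict Implicit. Unset Printing Implicit Defensive.
Import Order.TTheory GRing.Theory Num.Theory.
Local Open Scope ring_scope.

(** Formally the trace T of [P] satisfies T = 1 + nT - n: every word has n one-letter extensions,
    and the n unit vectors [v_j] carry total mass n. Hence T = 1 as soon as T is finite. Infinite
    trace is the obstacle, and [1 = sum_j v_j v_j^*] excludes it because in norm each [v_j] is
    nearly a polynomial, whose adjoint maps long words back into [A_n]. [P] is handled through its
    values on words, which are elements of [A_n] itself: each differs from a right translate of the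
    previous one by a finite combination of the [v_j]. The comparison of norms is used twice, for
    the seminorm pulled back along [alpha] and for the norm of the vacuum representation. The second
    use turns the vanishing of the vector [P s_i - c g] into an equation in the algebra. The first
    gives [alpha] closed range, so approximating each [s_i] by polynomials in the [v_j] is
    enough. *)

(** * Real-valued absolute value on [R[i]] *)

Section ComplexAbs.
Variable R : realType.
Implicit Types c d : R[i].

Definition cabs c : R := complex.Re `|c|.

Lemma cabsE c : (cabs c)%:C%C = `|c|.
Proof. by rewrite /cabs normc_def. Qed.

Lemma cabs_ge0 c : 0 <= cabs c.
Proof. by have := normr_ge0 c; rewrite -cabsE ler0c. Qed.

Lemma cabs_eq0 c : cabs c = 0 -> c = 0.
Proof. by move=> h; apply/normr0_eq0; rewrite -cabsE h. Qed.

Lemma cabsM c d : cabs (c * d) = cabs c * cabs d.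
Proof. by apply: complexI; rewrite rmorphM !cabsE normrM. Qed.

Lemma cabsD c d : cabs (c + d) <= cabs c + cabs d.
Proof. by rewrite -lecR rmorphD !cabsE ler_normD. Qed.

Lemma cabsR (x : R) : cabs (x%:C)%C = `|x|.
Proof. by apply: complexI; rewrite cabsE normc_def /= expr0n addr0 sqrtr_sqr. Qed.

Lemma cabs_nat k : cabs k%:R = k%:R.
Proof. by rewrite -(rmorph_nat (real_complex R)) cabsR normr_nat. Qed.

Lemma cabs0 : cabs 0 = 0. Proof. exact: (cabs_nat 0). Qed.
Lemma cabs1 : cabs 1 = 1. Proof. exact: (cabs_nat 1). Qed.

Lemma cabsN c : cabs (- c) = cabs c.
Proof. by rewrite /cabs normrN. Qed.

Lemma cabs_conj c : cabs c^* = cabs c.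
Proof. by apply: complexI; rewrite !cabsE norm_conjC. Qed.

Lemma cabsV c : cabs c^-1 = (cabs c)^-1.
Proof. by apply: complexI; rewrite fmorphV !cabsE normfV. Qed.

Lemma cabs_i : cabs 'i = 1.
Proof. by apply: complexI; rewrite cabsE normCi. Qed.

Lemma cabs_sqr c : ((cabs c ^+ 2)%:C)%C = c^* * c.
Proof. by rewrite rmorphXn /= cabsE normCK mulrC. Qed.

Lemma Re_le_cabs c : `|complex.Re c| <= cabs c.
Proof. by rewrite -lecR cabsE normc_ge_Re. Qed.

Lemma Im_le_cabs c : `|complex.Im c| <= cabs c.
Proof.
rewrite -ler_sqr ?nnegrE ?cabs_ge0 //.
rewrite /cabs normc_def /= sqr_sqrtr ?addr_ge0 ?sqr_ge0 // real_normK ?num_real //.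
by rewrite lerDr sqr_ge0.
Qed.

Lemma cabs_le_ReIm c : cabs c <= `|complex.Re c| + `|complex.Im c|.
Proof.
rewrite -ler_sqr ?nnegrE ?cabs_ge0 ?addr_ge0 //.
rewrite {1}/cabs normc_def /= sqr_sqrtr ?addr_ge0 ?sqr_ge0 //.
rewrite sqrrD !real_normK ?num_real // -addrA lerD2l lerDr.
by rewrite mulrn_wge0 ?mulr_ge0.
Qed.

End ComplexAbs.

(** * Growth estimates and Cauchy sequences of real and complex numbers *)

Section RealFacts.
Variable R : realType.

Lemma bernoulli (d : R) k : 0 <= d -> 1 + k%:R * d <= (1 + d) ^+ k.
Proof.
move=> d0; elim: k => [|k IH]; first by rewrite mul0r addr0.
rewrite exprS; apply: le_trans (ler_wpM2l _ IH); last by rewrite addr_ge0.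
have : 0 <= k%:R * (d * d) :> R by rewrite !mulr_ge0.
by rewrite -natr1; nra.
Qed.

Lemma archi_mul (d x : R) : 0 < d -> exists k, x < k%:R * d.
Proof.
move=> d0; exists (Num.bound (`|x| / d)); rewrite -ltr_pdivrMr //.
apply: le_lt_trans (archi_boundP _); last by rewrite divr_ge0 // ltW.
by rewrite ler_pM2r ?invr_gt0 // ler_norm.
Qed.

Lemma geometric_lt (q e : R) : 0 <= q -> q < 1 -> 0 < e ->
  exists N, forall k, (N <= k)%N -> q ^+ k < e.
Proof.
move=> q0 q1 e0; have [->|qn0] := eqVneq q 0.
  by exists 1%N => -[|k] // _; rewrite expr0n.
have qp : 0 < q by rewrite lt_neqAle eq_sym qn0.
have qV : 0 < q^-1 - 1 by rewrite subr_gt0 invf_gt1.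
have [N hN] := archi_mul e^-1 qV.
exists N => k Nk; apply: (@le_lt_trans _ _ (q ^+ N)).
  by apply: ler_wiXn2l => //; apply: ltW.
have := @bernoulli (q^-1 - 1) N; rewrite subr_ge0 invf_ge1 // (ltW q1) => /(_ isT).
rewrite [1 + (_ - _)]addrC subrK exprVn => h.
rewrite -ltf_pV2 ?posrE ?exprn_gt0 //.
apply: lt_le_trans (h); apply: lt_trans hN _.
by rewrite ltrDr.
Qed.

Lemma real_cauchy_cvg (u : nat -> R) :
  (forall e, 0 < e -> exists N, forall m k, (N <= m)%N -> (N <= k)%N -> `|u m - u k| < e) ->
  exists l, forall e, 0 < e -> exists N, forall m, (N <= m)%N -> `|u m - l| < e.
Proof.
(* The supremum of this set of eventual lower bounds is the lower limit of [u]. *)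
move=> hu; pose S : set R := [set x | exists N, forall m, (N <= m)%N -> x <= u m]%classic.
have [N1 hN1] := hu 1 ltr01.
have S0 : S (u N1 - 1).
  exists N1 => m Nm; have := hN1 m N1 Nm (leqnn _).
  by rewrite ltr_distlC => /andP[]; lra.
have Sub e N : (forall m k, (N <= m)%N -> (N <= k)%N -> `|u m - u k| < e) ->
    ubound S (u N + e).
  move=> hN x [N' hN']; have := hN' _ (leq_maxr N N').
  have := hN _ _ (leq_maxl N N') (leqnn N); rewrite ltr_distl => /andP[]; lra.
have Ssup : has_sup S by split; [exists (u N1 - 1) | exists (u N1 + 1); exact: Sub].
exists (sup S) => e e0; have e2 : 0 < e / 2 by rewrite divr_gt0.
have [N hN] := hu _ e2; exists N => m Nm.
have h1 : sup S <= u N + e / 2 by apply: ge_sup; [exists (u N1 - 1) | exact: Sub].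
have h2 : u N - e / 2 <= sup S.
  apply: ub_le_sup; first by case: Ssup.
  exists N => k Nk; have := hN k N Nk (leqnn _); rewrite ltr_distl => /andP[]; lra.
have := hN m N Nm (leqnn _); rewrite !ltr_distl => /andP[h3 h4].
by apply/andP; split; lra.
Qed.

Lemma complex_cauchy_cvg (u : nat -> R[i]) :
  (forall e, 0 < e -> exists N, forall m k, (N <= m)%N -> (N <= k)%N -> cabs (u m - u k) < e) ->
  exists l, forall e, 0 < e -> exists N, forall m, (N <= m)%N -> cabs (u m - l) < e.
Proof.
move=> hu.
have part (f : R[i] -> R) : (forall z w, `|f z - f w| <= cabs (z - w)) ->
    exists l, forall e, 0 < e -> exists N, forall m, (N <= m)%N -> `|f (u m) - l| < e.
  move=> hf; apply: real_cauchy_cvg => e /hu [N hN]; exists N => m k Nm Nk.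
  exact: le_lt_trans (hf _ _) (hN m k Nm Nk).
have [a ha] := part (@complex.Re R) (fun z w => ltac:(rewrite -raddfB; exact: Re_le_cabs)).
have [b hb] := part (@complex.Im R) (fun z w => ltac:(rewrite -raddfB; exact: Im_le_cabs)).
exists (a +i* b)%C => e e0; have e2 : 0 < e / 2 by rewrite divr_gt0.
have [N hN] := ha _ e2; have [N' hN'] := hb _ e2; exists (maxn N N') => m.
rewrite geq_max => /andP[/hN h1 /hN' h2]; apply: le_lt_trans (cabs_le_ReIm _) _.
by rewrite !raddfB /=; lra.
Qed.

Lemma pow2_root_le (a b C : R) : 0 <= a -> 0 <= b ->
  (forall m, a ^+ (2 ^ m) <= C * (2 ^ m)%:R * b ^+ (2 ^ m)) -> a <= b.
Proof.
move=> a0 b0 h; case: leP => // ba.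
have [b_eq0|bn0] := eqVneq b 0.
  have := h 0%N; rewrite expn0 !expr1 b_eq0 mulr0 => a_le0.
  by move: ba; rewrite b_eq0 ltNge a_le0.
have bp : 0 < b by rewrite lt_neqAle eq_sym bn0.
pose d := a / b - 1.
have dp : 0 < d by rewrite subr_gt0 ltr_pdivlMr // mul1r.
have hd m : (1 + d) ^+ (2 ^ m) <= C * (2 ^ m)%:R.
  have -> : 1 + d = a / b by rewrite /d addrC subrK.
  by rewrite expr_div_n ler_pdivrMr ?exprn_gt0.
(* Bernoulli at exponent [M = 2 ^ k] grows only linearly, like the right-hand side. Squared, at
   exponent [2 * M], it gives [(M * d) ^+ 2], which exceeds [2 * C * M] for this [k]. *)
have [k hk] := archi_mul (2 * C) (mulr_gt0 dp dp).
have := hd k.+1; rewrite expnS mulnC exprM.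
have kM : k%:R <= (2 ^ k)%:R :> R by rewrite ler_nat ltnW // ltn_expl.
set M : R := (2 ^ k)%:R in kM *.
have Mp : 0 < M by rewrite ltr0n expn_gt0.
have := @bernoulli d (2 ^ k) (ltW dp); rewrite -/M; set P := (1 + d) ^+ _ => hP.
rewrite expr2 natrM -/M => h1.
have h2 : (M * d) * (M * d) <= P * P.
  have Md : 0 <= M * d by rewrite mulr_ge0 // ltW.
  by apply: ler_pM => //; lra.
have h3 : k%:R * (d * d) <= M * (d * d) by rewrite ler_wpM2r // mulr_ge0 // ltW.
have h4 : M * (M * (d * d)) <= M * (2 * C) by lra.
by move: h4; rewrite ler_pM2l // => h4; lra.
Qed.

End RealFacts.

(** * Norm, involution and limits in a C*-algebra *)

Section CStarFacts.
Variables (R : realType) (A : algType R[i]) (star : A -> A) (nrm : A -> R).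
Hypothesis hA : is_cstar_algebra star nrm.
Implicit Types (x y z h : A) (c d : R[i]).

Definition lim_to (u : nat -> A) (l : A) :=
  forall e : R, 0 < e -> exists N, forall m, (N <= m)%N -> nrm (u m - l) < e.

Lemma nrm_ge0 x : 0 <= nrm x. Proof. exact: cs_nrm_ge0 hA x. Qed.

Lemma nrmD x y : nrm (x + y) <= nrm x + nrm y.
Proof. exact: cs_nrm_triangle hA x y. Qed.

Lemma nrmM x y : nrm (x * y) <= nrm x * nrm y.
Proof. exact: cs_nrm_submult hA x y. Qed.

Lemma nrmZ c x : nrm (c *: x) = cabs c * nrm x.
Proof. by apply: complexI; rewrite (cs_nrm_scale hA) -cabsE -rmorphM. Qed.

Lemma nrm0 : nrm 0 = 0.
Proof. by have := nrmZ 0 0; rewrite scale0r cabs0 mul0r. Qed.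

Lemma nrmN x : nrm (- x) = nrm x.
Proof. by rewrite -scaleN1r nrmZ cabsN cabs1 mul1r. Qed.

Lemma nrmB x y : nrm (x - y) <= nrm x + nrm y.
Proof. by rewrite -(nrmN y); exact: nrmD. Qed.

Lemma nrm_distC x y : nrm (x - y) = nrm (y - x).
Proof. by rewrite -nrmN opprB. Qed.

Lemma nrm_dist_triangle y x z : nrm (x - z) <= nrm (x - y) + nrm (y - z).
Proof. by apply: le_trans (nrmD _ _); rewrite addrA subrK. Qed.

Lemma nrm_le_dist x y : nrm x <= nrm y + nrm (x - y).
Proof. by apply: le_trans (nrmD _ _); rewrite addrC subrK. Qed.

Lemma nrm_eq0 x : nrm x <= 0 -> x = 0.
Proof. by move=> h; apply: (cs_nrm_eq0 hA); apply/le_anti; rewrite h nrm_ge0. Qed.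

Lemma nrm_sum (I : Type) (r : seq I) (P : pred I) (F : I -> A) :
  nrm (\sum_(i <- r | P i) F i) <= \sum_(i <- r | P i) nrm (F i).
Proof.
elim/big_ind2 : _ => [|x a y b xa yb|//]; first by rewrite nrm0.
by apply: le_trans (nrmD _ _) _; apply: lerD.
Qed.

Lemma starD x y : star (x + y) = star x + star y.
Proof. exact: cs_star_add hA x y. Qed.

Lemma starZ c x : star (c *: x) = c^* *: star x.
Proof. exact: cs_star_scale hA c x. Qed.

Lemma starM x y : star (x * y) = star y * star x.
Proof. exact: cs_star_mul hA x y. Qed.

Lemma starK x : star (star x) = x.
Proof. exact: cs_star_invol hA x. Qed.

Lemma star0 : star 0 = 0.
Proof. by have := starZ 0 0; rewrite scale0r conjC0 scale0r. Qed.

Lemma starN x : star (- x) = - star x.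
Proof. by rewrite -scaleN1r starZ rmorphN1 scaleN1r. Qed.

Lemma starB x y : star (x - y) = star x - star y.
Proof. by rewrite starD starN. Qed.

Lemma star1 : star 1 = 1.
Proof. by rewrite -[LHS]mulr1 -{2}[1]starK -starM mulr1 starK. Qed.

Lemma star_sum (I : Type) (r : seq I) (P : pred I) (F : I -> A) :
  star (\sum_(i <- r | P i) F i) = \sum_(i <- r | P i) star (F i).
Proof. exact: (big_morph star starD star0). Qed.

Lemma starX x k : star (x ^+ k) = star x ^+ k.
Proof. by elim: k => [|k IH]; rewrite ?star1 // exprS starM IH -exprSr. Qed.

Lemma nrm_starM x : nrm (star x * x) = nrm x ^+ 2.
Proof. exact: cs_cstar_identity hA x. Qed.

Lemma nrm_star x : nrm (star x) = nrm x.
Proof.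
suff le y : nrm y <= nrm (star y).
  by apply: le_anti; rewrite le andbT -{2}[x]starK le.
have [->|y0] := eqVneq (nrm y) 0; first exact: nrm_ge0.
have yp : 0 < nrm y by rewrite lt_neqAle eq_sym y0 nrm_ge0.
by rewrite -(ler_pM2r yp) -expr2 -nrm_starM; exact: nrmM.
Qed.

Lemma nrm1 : nrm 1 = 1.
Proof.
have n0 : nrm 1 != 0 by apply/eqP => /(cs_nrm_eq0 hA) /eqP; rewrite oner_eq0.
by apply: (mulfI n0); rewrite mulr1 -expr2 -nrm_starM star1 mulr1.
Qed.

Lemma nrm_scalar c : nrm (c *: 1) = cabs c.
Proof. by rewrite nrmZ nrm1 mulr1. Qed.

Lemma nrm_isometry x : star x * x = 1 -> nrm x = 1.
Proof.
move=> h; apply/eqP; rewrite -(@eqrXn2 _ 2) ?nrm_ge0 //.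
by rewrite -nrm_starM h nrm1 expr1n.
Qed.

Lemma nrm_selfadj x : star x = x -> nrm (x * x) = nrm x ^+ 2.
Proof. by move=> h; rewrite -nrm_starM h. Qed.

Lemma nrm_selfadj_pow2 x m : star x = x -> nrm (x ^+ (2 ^ m)) = nrm x ^+ (2 ^ m).
Proof.
move=> h; elim: m => [|m IH]; first by rewrite expn0 !expr1.
rewrite expnS mulnC !exprM (expr2 (x ^+ _)) nrm_selfadj ?IH //.
by rewrite starX h.
Qed.

Lemma lim_to_uniq u l l' : lim_to u l -> lim_to u l' -> l = l'.
Proof.
move=> ul ul'; apply/eqP; rewrite -subr_eq0; apply/eqP/nrm_eq0.
apply/ler_addgt0Pl => e e0; rewrite addr0; have e2 : 0 < e / 2 by rewrite divr_gt0.
have [N hN] := ul _ e2; have [N' hN'] := ul' _ e2.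
apply: le_trans (nrm_dist_triangle (u (maxn N N')) _ _) _.
have := hN _ (leq_maxl N N'); have := hN' _ (leq_maxr N N').
by rewrite (nrm_distC l); lra.
Qed.

Lemma geometric_cvg (u : nat -> A) (q : R) : 0 <= q -> q < 1 ->
  (forall k, nrm (u k.+1 - u k) <= q ^+ k) -> exists l, lim_to u l.
Proof.
move=> q0 q1 hu.
have tail k j : nrm (u (k + j)%N - u k) <= q ^+ k / (1 - q).
  have q1' : 0 < 1 - q by rewrite subr_gt0.
  suff : nrm (u (k + j)%N - u k) <= q ^+ k / (1 - q) * (1 - q ^+ j).
    move=> h; apply: le_trans h _; rewrite ler_piMr //.
      by rewrite divr_ge0 ?exprn_ge0 // ltW.
    by rewrite gerBl exprn_ge0.
  elim: j => [|j IH]; first by rewrite addn0 !subrr nrm0 mulr0.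
  rewrite addnS; apply: le_trans (nrm_dist_triangle (u (k + j)%N) _ _) _.
  apply: le_trans (lerD (hu _) IH) _.
  rewrite exprD exprS le_eqVlt; apply/orP; left; apply/eqP; field.
  by rewrite gt_eqF.
apply: (cs_complete hA) => e e0.
have q1' : 0 < 1 - q by rewrite subr_gt0.
have [N hN] := geometric_lt q0 q1 (mulr_gt0 (divr_gt0 e0 (ltr0n _ 2)) q1').
have hN' : q ^+ N / (1 - q) < e / 2 by rewrite ltr_pdivrMr // hN.
exists N => m k Nm Nk; apply: le_lt_trans (nrm_dist_triangle (u N) _ _) _.
rewrite (nrm_distC (u N)) -(subnKC Nm) -(subnKC Nk).
have := tail N (m - N)%N; have := tail N (k - N)%N; lra.
Qed.

Lemma lim_to_star u l : lim_to u l -> lim_to (fun k => star (u k)) (star l).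
Proof.
move=> h e /h [N hN]; exists N => m /hN.
by rewrite -starB nrm_star.
Qed.

Lemma lim_to_bounded (F : A -> A) (K : R) u l : (forall x y, F (x - y) = F x - F y) ->
  (forall x, nrm (F x) <= K * nrm x) -> lim_to u l -> lim_to (F \o u) (F l).
Proof.
move=> FB FK h e e0.
have K0 : 0 < `|K| + 1 by rewrite ltr_wpDl.
have [N hN] := h _ (divr_gt0 e0 K0); exists N => m /hN hm.
rewrite /= -FB; apply: le_lt_trans (FK _) _.
apply: (@le_lt_trans _ _ ((`|K| + 1) * nrm (u m - l))); last first.
  by rewrite mulrC -ltr_pdivlMr.
by rewrite ler_wpM2r ?nrm_ge0 // (le_trans (ler_norm K)) // lerDl.
Qed.

Lemma lim_to_const l : lim_to (fun=> l) l.
Proof. by move=> e e0; exists 0%N => m _; rewrite subrr nrm0. Qed.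

Lemma lim_to_sqr u l : lim_to u l -> lim_to (fun k => u k * u k) (l * l).
Proof.
move=> h e e0; set K := 2 * nrm l + 1.
have K0 : 0 < K by rewrite ltr_wpDl // mulr_ge0 // nrm_ge0.
have [N hN] := h _ (divr_gt0 e0 K0); have [N' hN'] := h _ ltr01.
exists (maxn N N') => m; rewrite geq_max => /andP[/hN h1 /hN' h2].
have -> : u m * u m - l * l = (u m - l) * u m + l * (u m - l).
  by rewrite mulrBl mulrBr addrA subrK.
apply: le_lt_trans (nrmD _ _) _; apply: le_lt_trans (lerD (nrmM _ _) (nrmM _ _)) _.
move: h1; rewrite ltr_pdivlMr // => h1; apply: le_lt_trans h1.
have := nrm_le_dist (u m) l; have := nrm_ge0 (u m - l); have := nrm_ge0 l.
rewrite /K; set a := nrm (u m - l) in h2 *; set b := nrm (u m); set c := nrm l.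
move=> c0 a0 hb; suff : a * b <= a * (c + 1) by lra.
by apply: ler_wpM2l => //; lra.
Qed.

(* [c = 1 - u] where [u] is the fixed point of [u |-> (h^2 + u^2) / 2], reached by iteration. *)
Lemma selfadj_sqrt h : star h = h -> nrm h < 1 ->
  exists y, [/\ star y = y, y * h = h * y & y * y = 1 - h * h].
Proof.
move=> hs h1; pose f y : A := 2^-1 *: (h * h + y * y).
pose u k := iter k f 0.
have uS k : u k.+1 = f (u k) by [].
have comm_u x k : x * h = h * x -> x * u k = u k * x.
  move=> xh; elim: k => [|k IH]; first by rewrite mulr0 mul0r.
  rewrite uS /f -scalerAr -scalerAl; congr (_ *: _).
  by rewrite mulrDr mulrDl !mulrA xh IH -!mulrA xh IH.
have star_u k : star (u k) = u k.
  elim: k => [|k IH]; first exact: star0.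
  by rewrite uS /f starZ starD !starM IH hs fmorphV rmorph_nat.
have cabs2 : cabs (2^-1 : R[i]) = 2^-1 by rewrite cabsV cabs_nat.
have h0 := nrm_ge0 h.
have nrm_u k : nrm (u k) <= nrm h.
  elim: k => [|k IH]; first by rewrite nrm0.
  rewrite uS /f nrmZ cabs2.
  have := nrmD (h * h) (u k * u k); have := nrmM h h; have := nrmM (u k) (u k).
  have : nrm (u k) * nrm (u k) <= nrm h * nrm h by rewrite ler_pM ?nrm_ge0.
  have : nrm h * nrm h <= nrm h by rewrite ler_piMr // ltW.
  by move=> *; lra.
have step k : nrm (u k.+1 - u k) <= nrm h ^+ k.
  elim: k => [|k IH].
    rewrite subr0 uS /f mulr0 addr0 nrmZ cabs2 expr0.
    have := nrmM h h; have : nrm h * nrm h <= nrm h by rewrite ler_piMr // ltW.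
    by move=> *; lra.
  (* The iterates commute, so the difference of squares factors; half of [u k.+1 + u k] has norm at
     most [nrm h], whence the geometric rate. *)
  have -> : u k.+2 - u k.+1 = 2^-1 *: ((u k.+1 - u k) * (u k.+1 + u k)).
    have ab := comm_u _ k (esym (comm_u h k.+1 erefl)).
    rewrite (uS k.+1) {2}[u k.+1](uS k); move: (u k.+1) (u k) ab => a b ab.
    rewrite /f -scalerBr opprD addrACA subrr add0r; congr (_ *: _).
    by rewrite mulrDr !mulrBl ab addrA subrK.
  rewrite nrmZ cabs2 exprS.
  have := nrmM (u k.+1 - u k) (u k.+1 + u k); have := nrmD (u k.+1) (u k).
  have := nrm_u k; have := nrm_u k.+1; have := nrm_ge0 (u k.+1 - u k).
  have := nrm_ge0 (u k.+1 + u k).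
  set a := nrm (u k.+1 - u k) in IH *; set b := nrm (u k.+1 + u k) => *.
  have : a * b <= nrm h ^+ k * (2 * nrm h) by apply: ler_pM => //; lra.
  by move=> *; lra.
have [l ul] := geometric_cvg h0 h1 step.
have lh : l * h = h * l.
  apply/eqP; rewrite -subr_eq0; apply/eqP.
  pose F x := x * h - h * x.
  apply: (@lim_to_uniq (F \o u)).
    apply: (@lim_to_bounded F (nrm h + nrm h)) => // x.
      by move=> y; rewrite /F mulrBl mulrBr !opprD !opprK addrACA.
    apply: le_trans (nrmB _ _) _; apply: le_trans (lerD (nrmM _ _) (nrmM _ _)) _.
    by rewrite mulrDl [nrm x * _]mulrC.
  have -> : F \o u = fun=> 0; last exact: lim_to_const.
  by apply/funext => k; rewrite /= /F -(comm_u h) ?subrr.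
have ls : star l = l.
  apply: (@lim_to_uniq u) => //; have := lim_to_star ul.
  by congr lim_to; apply/funext => k; rewrite star_u.
have ll : l = f l.
  apply: (@lim_to_uniq (fun k => u k.+1)).
    by move=> e /ul [N hN]; exists N => m Nm; apply: hN; apply: leqW.
  move=> e e0; have [N hN] := lim_to_sqr ul e0; exists N => m /hN hm.
  rewrite uS /f -scalerBr opprD addrACA subrr add0r nrmZ cabs2.
  by have := nrm_ge0 (u m * u m - l * l); lra.
exists (1 - l); split; first by rewrite starB star1 ls.
  by rewrite mulrBl mulrBr mul1r mulr1 lh.
have : 2 *: l = h * h + l * l by rewrite {1}ll scalerA mulfV ?scale1r // pnatr_eq0.
rewrite scaler_nat mulr2n => l2.
have -> : h * h = l + l - l * l by rewrite l2 addrK.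
by rewrite mulrBl !mulrBr !mul1r !mulr1 !opprD !opprK !addrA.
Qed.

(** * Contractivity of star endomorphisms *)

Section StarEndo.
Variable alpha : A -> A.
Hypothesis ha : unital_star_endo star alpha.

Lemma endoD x y : alpha (x + y) = alpha x + alpha y. Proof. by case: ha. Qed.
Lemma endoZ c x : alpha (c *: x) = c *: alpha x. Proof. by case: ha. Qed.
Lemma endoM x y : alpha (x * y) = alpha x * alpha y. Proof. by case: ha. Qed.
Lemma endo1 : alpha 1 = 1. Proof. by case: ha. Qed.
Lemma endo_star x : alpha (star x) = star (alpha x). Proof. by case: ha. Qed.

Lemma endo0 : alpha 0 = 0.
Proof. by have := endoZ 0 0; rewrite !scale0r. Qed.

Lemma endoB x y : alpha (x - y) = alpha x - alpha y.
Proof. by rewrite -scaleN1r endoD endoZ scaleN1r. Qed.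

Lemma endo_sum (I : Type) (r : seq I) (P : pred I) (F : I -> A) :
  alpha (\sum_(i <- r | P i) F i) = \sum_(i <- r | P i) alpha (F i).
Proof. exact: (big_morph alpha endoD endo0). Qed.

(* A self-adjoint [h] of norm [< 1] is the mean of the unitaries [h +- i sqrt(1 - h^2)]. *)
Lemma star_endo_contractive x : nrm (alpha x) <= nrm x.
Proof.
have ball h : star h = h -> nrm h < 1 -> nrm (alpha h) <= 1.
  move=> hs h1; have [y [ys yh yy]] := selfadj_sqrt hs h1.
  pose U := h + 'i *: y; pose V := h - 'i *: y.
  have US : star U = V.
    by rewrite /U starD starZ hs ys conjCi scaleNr.
  have VS : star V = U by rewrite -US starK.
  have ii : 'i * 'i = -1 :> R[i] by rewrite -expr2 sqrCi.
  have VU : V * U = 1.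
    rewrite /U /V mulrBl !mulrDr -!scalerAr -!scalerAl scalerA ii yh yy.
    by rewrite scaleN1r opprD opprK addrA addrK addrC subrK.
  have UV : U * V = 1.
    rewrite /U /V mulrDl !mulrBr -!scalerAr -!scalerAl scalerA ii yh yy.
    by rewrite scaleN1r opprK addrA subrK addrC subrK.
  have nU : nrm (alpha U) = 1 by apply: nrm_isometry; rewrite -endo_star -endoM US VU endo1.
  have nV : nrm (alpha V) = 1 by apply: nrm_isometry; rewrite -endo_star -endoM VS UV endo1.
  have -> : h = 2^-1 *: (U + V).
    rewrite /U /V addrACA subrr addr0 -mulr2n -[h *+ 2]scaler_nat scalerA mulVf ?scale1r //.
    by rewrite pnatr_eq0.
  rewrite endoZ endoD nrmZ cabsV cabs_nat.
  by have := nrmD (alpha U) (alpha V); lra.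
have sadj h : star h = h -> nrm (alpha h) <= nrm h.
  move=> hs; apply/ler_addgt0Pl => e e0.
  set t := e + nrm h; have t0 : 0 < t by rewrite ltr_pwDl // nrm_ge0.
  have cV : cabs ((t%:C)%C^-1) = t^-1 by rewrite cabsV cabsR gtr0_norm.
  have tS : star ((t%:C)%C^-1 *: h) = (t%:C)%C^-1 *: h.
    rewrite starZ hs fmorphV; congr (_^-1 *: _); apply/CrealP.
    by rewrite realE ler0c ltW.
  have := ball _ tS; rewrite endoZ !nrmZ cV mulrC ltr_pdivrMr // mul1r /t ltrDr.
  by move=> /(_ e0); rewrite mulrC ler_pdivrMr // mul1r.
rewrite -ler_sqr ?nnegrE ?nrm_ge0 // -!nrm_starM -endo_star -endoM.
by apply: sadj; rewrite starM starK.
Qed.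

End StarEndo.

(* Averaging the squares of [1 + a h] and [1 + b h] with [a^2 + b^2 = 0] gives
   [1 + (a + b) h]; starting from the multipliers 1, i, -1, -i this yields contractions
   [1 + (1 + i)^k h] for every [k]. *)
Lemma extreme_unit h : star h = h -> nrm (1 + h) <= 1 -> nrm (1 - h) <= 1 -> h = 0.
Proof.
move=> hs hp hm; pose P c := nrm (1 + c *: h) <= 1.
have E t : (1 + t *: h) * (1 + t *: h) = 1 + 2 *: (t *: h) + (t * t) *: (h * h).
  by rewrite [2 *: _]scaler_nat mulr2n mulrDl mul1r mulrDr mulr1 -scalerAl -scalerAr
             scalerA !addrA.
have half (x y : A) : x + x = y -> x = 2^-1 *: y.
  by move=> <-; rewrite -mulr2n -[x *+ 2]scaler_nat scalerA mulVf ?pnatr_eq0 // scale1r.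
have avg a b : a * a + b * b = 0 -> P a -> P b -> P (a + b).
  move=> ab; rewrite /P => ha hb.
  have -> : 1 + (a + b) *: h = 2^-1 *: ((1 + a *: h) * (1 + a *: h)
                                       + (1 + b *: h) * (1 + b *: h)).
    apply: half; rewrite !E [RHS]addrACA -scalerDl ab scale0r addr0 [RHS]addrACA.
    by rewrite -scalerDr -[a *: h + _]scalerDl [2 *: _]scaler_nat mulr2n [LHS]addrACA.
  rewrite nrmZ cabsV cabs_nat.
  have := nrmD ((1 + a *: h) * (1 + a *: h)) ((1 + b *: h) * (1 + b *: h)).
  have := nrmM (1 + a *: h) (1 + a *: h); have := nrmM (1 + b *: h) (1 + b *: h).
  have := mulr_ile1 (nrm_ge0 _) (nrm_ge0 _) ha ha.
  have := mulr_ile1 (nrm_ge0 _) (nrm_ge0 _) hb hb.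
  by move=> *; lra.
have ii : 'i * 'i = -1 :> R[i] by rewrite -expr2 sqrCi.
(* By the C*-identity [nrm (1 + 'i *: h) ^+ 2] is the norm of [1 + h * h], so this average of two
   squares supplies the multiplier ['i]. *)
have hi : nrm (1 + h * h) <= 1.
  have -> : 1 + h * h = 2^-1 *: ((1 + 1 *: h) * (1 + 1 *: h)
                                 + (1 + -1 *: h) * (1 + -1 *: h)).
    apply: half; rewrite !E mulrNN !mulr1 !scaleN1r !scale1r scalerN.
    by rewrite [RHS]addrACA [1 + _ + (1 - _)]addrACA subrr addr0 -addrACA.
  rewrite nrmZ cabsV cabs_nat scale1r scaleN1r.
  have := nrmD ((1 + h) * (1 + h)) ((1 - h) * (1 - h)).
  have := nrmM (1 + h) (1 + h); have := nrmM (1 - h) (1 - h).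
  have := mulr_ile1 (nrm_ge0 _) (nrm_ge0 _) hp hp.
  have := mulr_ile1 (nrm_ge0 _) (nrm_ge0 _) hm hm.
  by move=> *; lra.
have star_i : star (1 + 'i *: h) = 1 + (- 'i) *: h.
  by rewrite starD star1 starZ hs conjCi.
have Pi : P 'i.
  rewrite /P -(@ler_pXn2r _ 2) ?nnegrE ?nrm_ge0 // expr1n -nrm_starM star_i.
  rewrite mulrDl mul1r mulrDr mulr1 -scalerAl -scalerAr scalerA mulNr ii opprK scale1r.
  by rewrite scaleNr addrA addrK.
have PNi : P (- 'i) by rewrite /P -star_i nrm_star.
pose S c := [/\ P c, P (- c), P ('i * c) & P (- ('i * c))].
have SS c : S c -> S ((1 + 'i) * c).
  have iic : ('i * c) * ('i * c) = - (c * c) by rewrite mulrACA ii mulN1r.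
  case=> p1 p2 p3 p4; split.
  - by rewrite mulrDl mul1r; apply: avg; rewrite // iic subrr.
  - by rewrite mulrDl mul1r opprD; apply: avg; rewrite // !mulrNN iic subrr.
  - have -> : 'i * ((1 + 'i) * c) = 'i * c + - c by rewrite mulrDl mul1r mulrDr !mulrA ii mulN1r.
    by apply: avg; rewrite // mulrNN iic addNr.
  - have -> : - ('i * ((1 + 'i) * c)) = c + - ('i * c).
      by rewrite mulrDl mul1r mulrDr !mulrA ii mulN1r opprB.
    by apply: avg; rewrite // mulrNN iic subrr.
have SX k : S ((1 + 'i) ^+ k).
  elim: k => [|k IH]; last by rewrite exprS; apply: SS.
  by rewrite expr0; split; rewrite ?mulr1 // /P ?scaleN1r ?scale1r.
(* Since [(1 + 'i) ^+ 2 = 2 * 'i], the multiplier at exponent [2 * k] has modulus [2 ^+ k], and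
   [c *: h] is half the difference of two contractions. *)
have bound k : 2 ^+ k * nrm h <= 1.
  have [p1 p2 _ _] := SX (2 * k)%N; move: p1 p2; rewrite exprM; set c := _ ^+ k.
  rewrite /P scaleNr => p1 p2.
  have cc : cabs c = 2 ^+ k.
    rewrite /c; elim: k {c p1 p2} => [|k IH]; first by rewrite !expr0 cabs1.
    rewrite [_ ^+ 2 ^+ k.+1]exprS [2 ^+ k.+1]exprS cabsM IH; congr (_ * _).
    have -> : (1 + 'i) ^+ 2 = 2 * 'i :> R[i].
      by rewrite sqrrD sqrCi expr1n mul1r addrAC subrr add0r mulr_natl.
    by rewrite cabsM cabs_nat cabs_i mulr1.
  rewrite -cc -nrmZ; have -> : c *: h = 2^-1 *: (1 + c *: h - (1 - c *: h)).
    by apply: half; rewrite opprD opprK addrACA subrr add0r.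
  by rewrite nrmZ cabsV cabs_nat; have := nrmB (1 + c *: h) (1 - c *: h); lra.
apply: nrm_eq0; rewrite leNgt; apply/negP => h0.
have [k hk] := archi_mul 1 h0; have := bound k; apply/negP; rewrite -ltNge.
apply: lt_le_trans hk _; rewrite ler_pM2r // -natrX ler_nat ltnW //.
exact: ltn_expl.
Qed.

(** * Orthogonality of the generators, words and homogeneous elements *)

Section CuntzRelations.
Variables (n : nat) (s : 'I_n -> A).
Hypothesis s_isom : forall i, star (s i) * s i = 1.
Hypothesis s_sum : \sum_(i < n) s i * star (s i) = 1.

Lemma nrm_proj_compl p : star p = p -> p * p = p -> nrm (1 - p) <= 1.
Proof.
move=> ps pp; have qs : star (1 - p) = 1 - p by rewrite starB star1 ps.
have qq : (1 - p) * (1 - p) = 1 - p.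
  by rewrite mulrBl mul1r mulrBr mulr1 pp subrr subr0.
have := nrm_selfadj qs; rewrite qq expr2.
have [->|h _] := eqVneq (nrm (1 - p)) 0; first by rewrite ler01.
have := nrm_selfadj qs; rewrite qq expr2 -{1}[nrm _]mulr1 => /(mulfI h) <-.
exact: lexx.
Qed.

Lemma nrm_gen i : nrm (s i) = 1.
Proof. exact: nrm_isometry. Qed.

(* Positivity in disguise: the elements [a k = s_j^* s_k s_k^* s_j] satisfy [|1 - a k| <= 1]
   and those with [k <> j] sum to zero, so [a i / n] meets [extreme_unit]. *)
Lemma gen_orth i j : star (s i) * s j = (i == j)%:R.
Proof.
case: eqVneq => [->|ij]; first exact: s_isom.
have n0 : (n%:R : R[i]) != 0 by rewrite pnatr_eq0 -lt0n (leq_ltn_trans _ (ltn_ord i)).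
pose a k := star (s j) * (s k * star (s k)) * s j.
have aj : a j = 1 by rewrite /a mulrA s_isom mul1r s_isom.
have a_sum : \sum_k a k = 1 by rewrite -mulr_suml -mulr_sumr s_sum mulr1 s_isom.
have a_le k : nrm (1 - a k) <= 1.
  have -> : 1 - a k = star (s j) * (1 - s k * star (s k)) * s j.
    by rewrite mulrBr mulr1 mulrBl s_isom.
  apply: le_trans (nrmM _ _) _; rewrite nrm_gen mulr1.
  apply: le_trans (nrmM _ _) _; rewrite nrm_star nrm_gen mul1r.
  apply: nrm_proj_compl; first by rewrite starM starK.
  by rewrite -mulrA [star _ * (_ * _)]mulrA s_isom mul1r.
have avg (b : 'I_n -> A) : (forall k, nrm (b k) <= 1) ->
    nrm (n%:R^-1 *: \sum_k b k) <= 1.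
  move=> b1; rewrite nrmZ cabsV cabs_nat mulrC ler_pdivrMr ?mul1r; last first.
    by rewrite ltr0n (leq_ltn_trans _ (ltn_ord i)).
  apply: le_trans (nrm_sum _ _ _) _.
  apply: le_trans (ler_sum _ (fun k _ => b1 k)) _.
  by rewrite sumr_const card_ord.
have single (x : A) l : \sum_(k < n) (if k == l then x else 0) = x.
  by rewrite -big_mkcond big_pred1_eq.
have ones : \sum_(k < n) (1 : A) = n%:R by rewrite sumr_const card_ord.
have one_n : (1 : A) = n%:R^-1 *: n%:R.
  have -> : (n%:R : A) = (n%:R : R[i]) *: 1 by rewrite scaler_nat.
  by rewrite scalerA mulVf // scale1r.
have ai0 : n%:R^-1 *: a i = 0.
  apply: extreme_unit.
  - by rewrite starZ fmorphV rmorph_nat /a !starM !starK !mulrA.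
  (* The elements [1 - a k] sum to [n - 1]; putting 1 in place of the terms at [j] and [i] adds
     [a j + a i = 1 + a i]. *)
  - have -> : 1 + n%:R^-1 *: a i = n%:R^-1 *: \sum_k
        (1 - a k + ((if k == j then a j else 0) + (if k == i then a i else 0))).
      rewrite !big_split /= !single sumrN a_sum aj ones addrA subrK scalerDr.
      by rewrite -one_n.
    apply: avg => k; case: (eqVneq k j) => [->|kj].
      by rewrite eq_sym (negPf ij) addr0 subrK nrm1.
    by case: eqVneq => [->|ki]; rewrite add0r ?subrK ?addr0 ?nrm1.
  - have -> : 1 - n%:R^-1 *: a i = n%:R^-1 *: \sum_k (1 - (if k == i then a i else 0)).
      by rewrite big_split /= sumrN single ones scalerBr -one_n.
    by apply: avg => k; case: eqVneq => [_|ki]; rewrite ?subr0 ?nrm1.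
have : a i = 0.
  by rewrite -[a i]scale1r -(mulfV n0) -scalerA ai0 scaler0.
move=> a0; apply: nrm_eq0; rewrite leNgt; apply/negP => h0.
have := nrm_starM (star (s i) * s j); rewrite starM starK mulrA -[_ * s i * _]mulrA -/(a i) a0 nrm0.
by move/eqP; rewrite eq_sym sqrf_eq0 gt_eqF.
Qed.

Definition sw (w : seq 'I_n) : A := \prod_(i <- w) s i.

Lemma sw_nil : sw [::] = 1. Proof. exact: big_nil. Qed.
Lemma sw_seq1 i : sw [:: i] = s i. Proof. exact: big_seq1. Qed.
Lemma sw_cons i w : sw (i :: w) = s i * sw w. Proof. exact: big_cons. Qed.
Lemma sw_cat u w : sw (u ++ w) = sw u * sw w. Proof. exact: big_cat. Qed.
Lemma sw_rcons w i : sw (rcons w i) = sw w * s i.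
Proof. by rewrite -cats1 sw_cat sw_seq1. Qed.

Lemma sw_isom w : star (sw w) * sw w = 1.
Proof.
elim: w => [|i w IH]; first by rewrite sw_nil star1 mulr1.
by rewrite sw_cons starM -mulrA [star (s i) * _]mulrA s_isom mul1r.
Qed.

Lemma nrm_sw w : nrm (sw w) = 1.
Proof. exact: nrm_isometry (sw_isom w). Qed.

Lemma sw_orth u w : size u = size w -> star (sw u) * sw w = (u == w)%:R.
Proof.
elim: u w => [|i u IH] [|j w] //= => [_|[uw]]; first by rewrite sw_nil star1 mulr1.
rewrite !sw_cons starM -mulrA [star (s i) * _]mulrA gen_orth eqseq_cons.
by case: eqVneq => _ /=; rewrite ?mul1r ?IH // mul0r mulr0.
Qed.

Fixpoint words k : seq (seq 'I_n) :=
  if k is k'.+1 then [seq rcons w i | w <- words k', i <- enum 'I_n] else [:: [::]].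

Lemma big_words0 (V : nmodType) (F : seq 'I_n -> V) : \sum_(w <- words 0) F w = F [::].
Proof. exact: big_seq1. Qed.

Lemma big_wordsS (V : nmodType) k (F : seq 'I_n -> V) :
  \sum_(w <- words k.+1) F w = \sum_(w <- words k) \sum_i F (rcons w i).
Proof.
rewrite [words _]/= big_allpairs_dep; apply: eq_bigr => w _.
by rewrite big_enum.
Qed.

Lemma mem_words k w : (w \in words k) = (size w == k).
Proof.
elim: k w => [|k IH] w; first by rewrite inE; case: w.
apply/allpairsP/idP => [[[v i] /= [vk _ ->]]|].
  by rewrite size_rcons eqSS -IH.
case/lastP: w => // w i; rewrite size_rcons eqSS -IH => wk.
by exists (w, i); rewrite mem_enum.
Qed.

Lemma uniq_words k : uniq (words k).
Proof.
elim: k => // k IH; apply: (allpairs_uniq IH (enum_uniq 'I_n)).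
by move=> [w i] [w' i'] _ _ /= /rcons_inj.
Qed.

Lemma size_words k : size (words k) = (n ^ k)%N.
Proof.
elim: k => // k IH; rewrite [words _]/= size_allpairs IH expnS mulnC.
by rewrite size_enum_ord.
Qed.

Lemma words_unit k : \sum_(w <- words k) sw w * star (sw w) = 1.
Proof.
elim: k => [|k IH]; first by rewrite big_words0 sw_nil star1 mulr1.
rewrite big_wordsS -[RHS]IH; apply: eq_bigr => w _.
have -> : sw w * star (sw w) = sw w * 1 * star (sw w) by rewrite mulr1.
rewrite -s_sum mulr_sumr mulr_suml; apply: eq_bigr => i _.
by rewrite sw_rcons starM !mulrA.
Qed.

Lemma big_words_delta (V : nzRingType) k w (F : seq 'I_n -> V) : size w = k ->
  \sum_(u <- words k) (u == w)%:R * F u = F w.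
Proof.
move=> wk; rewrite (bigD1_seq w) ?mem_words ?wk ?uniq_words //= eqxx mul1r.
by rewrite big1 ?addr0 // => u /negPf ->; rewrite mul0r.
Qed.

Lemma big_words_lt_delta (V : nzRingType) m w (F : seq 'I_n -> V) : (size w < m)%N ->
  \sum_(k < m) \sum_(u <- words k) (u == w)%:R * F u = F w.
Proof.
move=> wm; rewrite (bigD1 (Ordinal wm)) //= big_words_delta // big1 ?addr0 // => k kw.
rewrite big_seq big1 // => u; rewrite mem_words => /eqP uk.
case: eqP => [uw|_]; last by rewrite mul0r.
by case/eqP: kw; apply: val_inj; rewrite /= -uk uw.
Qed.

(* [x] is in the span of the [s_u s_w^*] with [|u| = a] and [|w| = b]. *)
Definition bihom a b x := forall u w, size u = a -> size w = b ->
  exists c, star (sw u) * x * sw w = c%:A.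

Lemma bihom0 a b : bihom a b 0.
Proof. by move=> u w _ _; exists 0; rewrite mulr0 mul0r scale0r. Qed.

Lemma bihomD a b x y : bihom a b x -> bihom a b y -> bihom a b (x + y).
Proof.
move=> hx hy u w ua wb; have [c hc] := hx u w ua wb; have [d hd] := hy u w ua wb.
by exists (c + d); rewrite mulrDr mulrDl hc hd scalerDl.
Qed.

Lemma bihomZ a b c x : bihom a b x -> bihom a b (c *: x).
Proof.
move=> hx u w ua wb; have [d hd] := hx u w ua wb.
by exists (c * d); rewrite -scalerAr -scalerAl hd scalerA.
Qed.

Lemma bihom_sum (I : Type) (r : seq I) (P : pred I) a b (F : I -> A) :
  (forall i, P i -> bihom a b (F i)) -> bihom a b (\sum_(i <- r | P i) F i).
Proof. by move=> h; elim/big_ind: _ => //; [exact: bihom0 | exact: bihomD]. Qed.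

Lemma bihom_star a b x : bihom a b x -> bihom b a (star x).
Proof.
move=> hx u w ub wa; have [c hc] := hx w u wa ub.
exists c^*; have -> : star (sw u) * star x * sw w = star (star (sw w) * x * sw u).
  by rewrite !starM starK mulrA.
by rewrite hc starZ star1.
Qed.

Lemma bihomM b a l x y : bihom a b x -> bihom b l y -> bihom a l (x * y).
Proof.
move=> hx hy u w ua wc.
have -> : star (sw u) * (x * y) * sw w =
    \sum_(t <- words b) (star (sw u) * x * sw t) * (star (sw t) * y * sw w).
  rewrite -[x in LHS]mulr1 -(words_unit b) mulr_sumr mulr_suml mulr_sumr mulr_suml.
  by apply: eq_bigr => t _; rewrite !mulrA.
rewrite big_seq; elim/big_ind: _ => [|p q [c1 ->] [c2 ->]|t].
- by exists 0; rewrite scale0r.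
- by exists (c1 + c2); rewrite scalerDl.
rewrite mem_words => /eqP tb; have [c1 ->] := hx u t ua tb; have [c2 ->] := hy t w tb wc.
by exists (c1 * c2); rewrite -scalerAl mul1r scalerA.
Qed.

(** Inserting the sum of the [s_i s_i^*] in the middle of [s_u s_w^*] lengthens both words and keeps
    the degree [a - b], so finitely many homogeneous elements can be brought to a common word
    length. *)
Lemma bihom_shift t a b x : bihom a b x -> bihom (a + t) (b + t) x.
Proof.
move=> hx; elim: t => [|t IH]; first by rewrite !addn0.
rewrite !addnS => u w; case/lastP: u => // u i; case/lastP: w => // w j.
rewrite !size_rcons => -[ua] [wb]; have [c hc] := IH u w ua wb.
exists (c * (i == j)%:R); rewrite !sw_rcons starM.
have -> : star (s i) * star (sw u) * x * (sw w * s j)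
        = star (s i) * (star (sw u) * x * sw w) * s j by rewrite !mulrA.
rewrite hc -scalerAr mulr1 -scalerAl gen_orth -scalerA; congr (_ *: _).
by case: (i == j); rewrite ?scale1r ?scale0r.
Qed.

Lemma bihom_shift_to a b a' b' x : bihom a b x -> (a <= a')%N ->
  (a' + b = a + b')%N -> bihom a' b' x.
Proof.
move=> hx aa' e; have := @bihom_shift (a' - a)%N _ _ _ hx; rewrite subnKC //.
by have -> : (b + (a' - a) = b')%N by lia.
Qed.

Lemma bihom_sw w : bihom (size w) 0 (sw w).
Proof.
move=> u [|//] uw _; exists (u == w)%:R; rewrite sw_nil mulr1 sw_orth //.
by case: eqP; rewrite ?scale1r ?scale0r.
Qed.

Lemma bihom1 : bihom 0 0 1.
Proof. by have := @bihom_sw [::]; rewrite sw_nil. Qed.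

Lemma bihom_gen i : bihom 1 0 (s i).
Proof. by have := @bihom_sw [:: i]; rewrite sw_seq1. Qed.

Lemma bihom_expand a b x :
  x = \sum_(u <- words a) \sum_(w <- words b) sw u * (star (sw u) * x * sw w) * star (sw w).
Proof.
rewrite -{1}[x]mulr1 -(words_unit b) -[x * _]mul1r -(words_unit a) mulr_suml.
apply: eq_bigr => u _; rewrite !mulr_sumr; apply: eq_bigr => w _.
by rewrite !mulrA.
Qed.

(* The coefficient of ['X^k] is the component of degree [k - D]; all components share the
   same right-hand word length [L + D]. *)
Definition graded D x := exists (p : {poly A}) (L : nat),
  [/\ (size p <= D.*2.+1)%N, p.[1] = x & forall k, bihom (L + k) (L + D) p`_k].

Lemma graded_lift L' D x : graded D x -> exists (p : {poly A}) (L : nat),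
  [/\ (L' <= L)%N, (size p <= D.*2.+1)%N, p.[1] = x & forall k, bihom (L + k) (L + D) p`_k].
Proof.
case=> p [L [sp px hp]]; exists p, (L + L')%N; split=> //; first exact: leq_addl.
move=> k; rewrite -addnAC -(addnAC _ D); exact: bihom_shift.
Qed.

Lemma horner1M (p q : {poly A}) : (p * q).[1] = p.[1] * q.[1].
Proof. by rewrite hornerM_comm // /comm_poly mulr1 mul1r. Qed.

Lemma graded_bihom a b x : bihom a b x -> graded (a + b) x.
Proof.
move=> hx; exists (x%:P * 'X^(a.*2)), 0%N; split.
- apply: leq_trans (size_polyMleq _ _) _; rewrite size_polyXn addnS /=.
  apply: leq_trans (leq_add (size_polyC_leq1 x) (leqnn _)) _.
  by rewrite add1n ltnS leq_double leq_addr.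
- by rewrite horner1M hornerC hornerXn expr1n mulr1.
move=> k; rewrite coefMXn coefC; case: ltnP => [_|ka]; first exact: bihom0.
case: eqP => [k2|_]; last exact: bihom0.
have -> : k = (a + a)%N by apply/eqP; rewrite addnn eqn_leq ka -subn_eq0 k2 eqxx.
rewrite !add0n [(a + b)%N]addnC; exact: bihom_shift.
Qed.

Lemma graded_leq E D x : graded D x -> graded (D + E) x.
Proof.
case=> p [L [sp px hp]]; exists (p * 'X^E), L; split.
- apply: leq_trans (size_polyMleq _ _) _; rewrite size_polyXn addnS /=.
  apply: leq_trans (leq_add sp (leqnn _)) _.
  by rewrite doubleD addSn ltnS leq_add2l -addnn leq_addr.
- by rewrite horner1M hornerXn expr1n mulr1.
move=> k; rewrite coefMXn; case: ltnP => [_|kE]; first exact: bihom0.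
have := @bihom_shift E _ _ _ (hp (k - E)%N); by rewrite -!addnA subnK.
Qed.

Lemma gradedD D D' x y : graded D x -> graded D' y -> graded (D + D') (x + y).
Proof.
move=> /(graded_leq D') hx /(graded_leq D); rewrite [(D' + D)%N]addnC => hy.
have [q [L' [_ sq qy hq]]] := graded_lift 0 hy.
have [p [L [LL sp px hp]]] := graded_lift L' hx.
exists (p + q), L; split; first by rewrite (leq_trans (size_polyD _ _)) // geq_max sp.
  by rewrite hornerD px qy.
move=> k; rewrite coefD; apply: bihomD => //.
apply: bihom_shift_to (hq k) _ _; lia.
Qed.

Lemma gradedZ D c x : graded D x -> graded D (c *: x).
Proof.
case=> p [L [sp px hp]]; exists ((c *: 1)%:P * p), L; split.
- apply: leq_trans (size_polyMleq _ _) _; rewrite -subn1 leq_subLR.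
  by rewrite add1n -[_.*2.+2]add1n leq_add ?size_polyC_leq1.
- by rewrite horner1M hornerC px -scalerAl mul1r.
by move=> k; rewrite coefCM -scalerAl mul1r; apply: bihomZ.
Qed.

Lemma gradedM D D' x y : graded D x -> graded D' y -> graded (D + D') (x * y).
Proof.
move=> hx hy.
have [p [L [_ sp px hp]]] := graded_lift 0 hx.
have [q [L' [LL sq qy hq]]] := graded_lift (L + D)%N hy.
have DL : (D <= L')%N by rewrite (leq_trans _ LL) // leq_addl.
(* The coefficient of [p] at [i] is lengthened until its right-hand words match the left-hand ones
   of [q] at [k - i], of length [L' + (k - i)]. This needs [L + D <= L'] and leaves left-hand words
   of length [L' - D + k]. *)
exists (p * q), (L' - D)%N; split.
- apply: leq_trans (size_polyMleq _ _) _; rewrite -subn1 leq_subLR.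
  by apply: leq_trans (leq_add sp sq) _; rewrite doubleD addnS addSn add1n.
- by rewrite horner1M px qy.
move=> k; rewrite coefM; apply: bihom_sum => i _.
have ik : (i <= k)%N by rewrite -ltnS.
apply: (@bihomM (L' + (k - i))); last first.
  by apply: bihom_shift_to (hq (k - i)%N) _ _; [lia | lia].
apply: bihom_shift_to (hp i) _ _; lia.
Qed.

Lemma graded_star D x : graded D x -> graded D (star x).
Proof.
case=> p [L [sp px hp]].
(* The adjoint negates degrees, hence reverses the coefficients about [D]; the old right-hand length
   [L + D] becomes the base length. *)
exists (\poly_(k < D.*2.+1) star p`_(D.*2 - k)), (L + D)%N; split.
- exact: size_poly.
- rewrite horner_poly -px (horner_coef_wide _ sp) star_sum (reindex_inj rev_ord_inj) /=.
  apply: eq_bigr => k _; rewrite !expr1n !mulr1 subSS.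
  by congr (star p`_ _); have := ltn_ord k; lia.
move=> k; rewrite coef_poly; case: ltnP => [kD|_]; last exact: bihom0.
have h := bihom_star (hp (D.*2 - k)%N).
apply: bihom_shift_to h _ _; lia.
Qed.

Lemma star_poly_graded x : star_poly star s x -> exists D, graded D x.
Proof.
elim=> {x} [i||x y _ [D hx] _ [D' hy]|c x _ [D hx]|x y _ [D hx] _ [D' hy]|x _ [D hx]].
- by exists (1 + 0)%N; apply: graded_bihom; exact: bihom_gen.
- by exists (0 + 0)%N; apply: graded_bihom; exact: bihom1.
- by exists (D + D')%N; apply: gradedD.
- by exists D; apply: gradedZ.
- by exists (D + D')%N; apply: gradedM.
- by exists D; apply: graded_star.
Qed.

(** * Spikes, compressors and the extraction of homogeneous components *)

Variables i0 i1 : 'I_n.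
Hypothesis i01 : i0 != i1.

(** The closing letter [i1] records [N], so different spikes have orthogonal ranges, yet each starts
    with every power [j <= N] of [i0]. Conjugation by a spike therefore preserves scalars and kills
    elements of nonzero degree once [N] is large. *)
Definition spike N := sw (rcons (nseq N i0) i1).

Lemma nrm_spike N : nrm (spike N) = 1. Proof. exact: nrm_sw. Qed.

Lemma spike_isom N : star (spike N) * spike N = 1. Proof. exact: sw_isom. Qed.

Lemma spike_split j N : (j <= N)%N -> spike N = sw (nseq j i0) * spike (N - j).
Proof. by move=> jN; rewrite /spike -sw_cat -rcons_cat -nseqD subnKC. Qed.

Lemma spike_orth M N : M != N -> star (spike M) * spike N = 0.
Proof.
suff lt M' N' : (M' < N')%N -> star (spike M') * spike N' = 0.
  rewrite neq_ltn => /orP[/lt //|/lt h].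
  by rewrite -[spike N]starK -starM h star0.
move=> h; rewrite (spike_split (ltnW h)) {1}/spike sw_rcons starM -mulrA.
rewrite [star (sw _) * _]mulrA sw_isom mul1r.
have : (0 < N' - M')%N by rewrite subn_gt0.
case: (N' - M')%N => // k _; rewrite /spike /= sw_cons mulrA gen_orth.
by rewrite eq_sym (negPf i01) mul0r.
Qed.

(** [z] is a combination of words of length [j]. Against the left spike only the power of [i0]
    survives, and it leaves [spike (N - j)] facing [spike N]. *)
Lemma spike_kill N j z : bihom j 0 z -> (0 < j <= N)%N ->
  star (spike N) * z * spike N = 0.
Proof.
move=> hz /andP[j0 jN].
rewrite -[z]mul1r -(words_unit j) !(mulr_sumr, mulr_suml) big_seq big1 // => t.
rewrite mem_words => /eqP tj; have [c] := hz t [::] tj erefl.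
rewrite sw_nil mulr1 => hc.
rewrite -[_ * _ * z]mulrA hc -scalerAr mulr1 -scalerAr -scalerAl.
rewrite {1}(spike_split jN) starM -[_ * _ * sw t]mulrA sw_orth ?size_nseq //.
case: eqP => _; rewrite ?mulr0 ?mul0r ?scaler0 // mulr1 spike_orth ?scaler0 //.
by apply/eqP; lia.
Qed.

(** An isometry whose two-sided compression filters by degree: in the matching bidegree the inner
    [s_v^* y s_w] are scalars and pass through the spikes, while in other degrees within reach of
    [N] the spikes kill them. *)
Definition compressor M N := \sum_(u <- words M) sw u * spike N * star (sw u).

Lemma compressorE M' M N y : star (compressor M' N) * y * compressor M N =
  \sum_(v <- words M') \sum_(w <- words M)
     sw v * (star (spike N) * (star (sw v) * y * sw w) * spike N) * star (sw w).
Proof.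
rewrite /compressor star_sum !mulr_suml; apply: eq_bigr => v _.
rewrite mulr_sumr; apply: eq_bigr => w _.
by rewrite !starM starK !mulrA.
Qed.

Lemma compressor_id M' M N y : bihom M' M y ->
  star (compressor M' N) * y * compressor M N = y.
Proof.
move=> hy; rewrite compressorE [RHS](bihom_expand M' M) big_seq [RHS]big_seq.
apply: eq_bigr => v; rewrite mem_words => /eqP vM.
rewrite big_seq [RHS]big_seq; apply: eq_bigr => w; rewrite mem_words => /eqP wM.
have [c ->] := hy v w vM wM.
by rewrite -scalerAr mulr1 -scalerAl spike_isom.
Qed.

Lemma compressor_kill M' M N j y : (0 < j <= N)%N -> bihom (M' + j) M y ->
  star (compressor M' N) * y * compressor M N = 0.
Proof.
move=> hj hy; rewrite compressorE big_seq big1 // => v; rewrite mem_words => /eqP vM.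
rewrite big_seq big1 // => w; rewrite mem_words => /eqP wM.
rewrite (@spike_kill _ j) ?mulr0 ?mul0r // => u [|//] uj _.
have vuM : size (v ++ u) = (M' + j)%N by rewrite size_cat vM uj.
have [c hc] := hy _ w vuM wM; exists c; rewrite -hc sw_cat starM sw_nil mulr1.
by rewrite !mulrA.
Qed.

Lemma compressor_kill' M' M N j y : (0 < j <= N)%N -> bihom M' (M + j) y ->
  star (compressor M' N) * y * compressor M N = 0.
Proof.
move=> hj /bihom_star hy; have := compressor_kill hj hy.
by move/(congr1 star); rewrite !starM !starK star0 mulrA.
Qed.

Lemma nrm_compressor M N : nrm (compressor M N) = 1.
Proof.
apply: nrm_isometry; have := @compressor_id M M N 1.
by rewrite mulr1; apply; exact: (bihom_shift (t := M) bihom1).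
Qed.

Lemma sandwich_sum (I : Type) (r : seq I) (P : pred I) (x y : A) (F : I -> A) :
  x * (\sum_(i <- r | P i) F i) * y = \sum_(i <- r | P i) x * F i * y.
Proof. by rewrite mulr_sumr mulr_suml. Qed.

(** Two indices of [p] differ by at most [2 * D], which is why spikes of that length isolate one
    coefficient. Compressors have norm 1, so a C*-seminorm below [nrm] is no larger on a component
    than on [x]. *)
Lemma graded_component D x (p : {poly A}) L k : (size p <= D.*2.+1)%N -> p.[1] = x ->
  (forall k, bihom (L + k) (L + D) p`_k) ->  (k < D.*2.+1)%N ->
  star (compressor (L + k) D.*2) * x * compressor (L + D) D.*2 = p`_k.
Proof.
move=> sp px hp kD; rewrite -px (horner_coef_wide _ sp) sandwich_sum.
rewrite (bigD1 (Ordinal kD)) //= expr1n mulr1 compressor_id // big1 ?addr0 // => i ik.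
rewrite expr1n mulr1; have := ltn_ord i => iD.
have {}ik : (i != k :> nat)%N by [].
case: (ltnP k i) => ki.
  apply: (@compressor_kill _ _ _ (i - k)); first by lia.
  by have -> : (L + k + (i - k) = L + i)%N by lia.
apply: (@compressor_kill' _ _ _ (k - i)); first by lia.
by apply: bihom_shift_to (hp i) _ _; lia.
Qed.

(* [Bd x c] is to be thought of as [N x <= c] for a second C*-seminorm [N <= nrm].
   Powers [h^(2^m)] of a self-adjoint [h] have linearly many homogeneous components, each of
   norm at most [c^(2^m)], and taking roots removes that factor. *)
Section NormUniqueness.
Variable Bd : A -> R -> Prop.
Hypothesis Bd_ge0 : forall x a, Bd x a -> 0 <= a.
Hypothesis BdM : forall x y a b, Bd x a -> Bd y b -> Bd (x * y) (a * b).
Hypothesis Bd_star : forall x a, Bd x a -> Bd (star x) a.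
Hypothesis Bd_nrm : forall x, Bd x (nrm x).
Hypothesis Bd_scalar : forall c a, Bd c%:A a -> cabs c <= a.

Lemma Bd_pow2 x a m : Bd x a -> Bd (x ^+ (2 ^ m)) (a ^+ (2 ^ m)).
Proof.
move=> h; elim: m => [|m IH]; first by rewrite expn0 !expr1.
by rewrite expnS mulnC !exprM !(expr2 (_ ^+ (2 ^ m))); apply: BdM.
Qed.

Lemma Bd_selfadj h a C : star h = h -> Bd h a ->
  (forall m, nrm (h ^+ (2 ^ m)) <= C * (2 ^ m)%:R * a ^+ (2 ^ m)) -> nrm h <= a.
Proof.
move=> hs ha hm; apply: (@pow2_root_le _ _ _ C); [exact: nrm_ge0 | exact: Bd_ge0 ha|].
by move=> m; rewrite -nrm_selfadj_pow2.
Qed.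

(** Elements of bidegree [k], [k] form a matrix algebra with units [s_u s_w^*]. Bounding entries
    loses a factor [n ^ (2 * k)], the same for all powers of [star x * x], so taking roots removes
    it. *)
Lemma nrm_core_le k x a : bihom k k x -> Bd x a -> nrm x <= a.
Proof.
move=> hx ha; have a0 := Bd_ge0 ha.
have crude y b : bihom k k y -> Bd y b -> nrm y <= (n ^ k)%:R * (n ^ k)%:R * b.
  move=> hy hb; rewrite {1}(bihom_expand k k y).
  have card (V : R) : \sum_(u <- words k) V = (n ^ k)%:R * V.
    by rewrite big_const_seq count_predT size_words iter_addr_0 mulr_natl.
  rewrite -mulrA -!card; apply: le_trans (nrm_sum _ _ _) _.
  rewrite big_seq [leRHS]big_seq; apply: ler_sum => u; rewrite mem_words => /eqP uk.
  apply: le_trans (nrm_sum _ _ _) _.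
  rewrite big_seq [leRHS]big_seq; apply: ler_sum => w; rewrite mem_words => /eqP wk.
  have [c hc] := hy u w uk wk.
  have cb : cabs c <= b.
    apply: Bd_scalar; rewrite -hc -[b]mulr1 -[b]mul1r.
    apply: BdM; last by rewrite -(nrm_sw w).
    by apply: BdM => //; rewrite -(nrm_sw u) -nrm_star.
  rewrite hc -scalerAr mulr1 -scalerAl nrmZ; apply: le_trans cb => //.
  rewrite ler_piMr ?cabs_ge0 //; apply: le_trans (nrmM _ _) _.
  by rewrite nrm_star !nrm_sw mulr1.
rewrite -ler_sqr ?nnegrE ?nrm_ge0 // -nrm_starM expr2.
have hy : bihom k k (star x * x) by apply: (bihomM _ hx); apply: bihom_star.
have yb : Bd (star x * x) (a * a) by apply: BdM => //; apply: Bd_star.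
apply: (@Bd_selfadj _ _ ((n ^ k)%:R * (n ^ k)%:R)) => //; first by rewrite starM starK.
move=> m; have hym : bihom k k ((star x * x) ^+ (2 ^ m)).
  elim: m => [|m IH]; first by rewrite expn0 expr1.
  by rewrite expnS mulnC exprM expr2; exact: (bihomM IH IH).
apply: le_trans (crude _ _ hym (Bd_pow2 m yb)) _.
apply: ler_wpM2r; first by rewrite exprn_ge0 // mulr_ge0.
by rewrite ler_peMr ?mulr_ge0 // ler1n expn_gt0.
Qed.

(** Each component comes from [x] by compression between isometries, and its square [star p_k * p_k]
    lies in the core treated by [nrm_core_le]. *)
Lemma nrm_graded_le D x a : graded D x -> Bd x a -> nrm x <= (D.*2.+1)%:R * a.
Proof.
case=> p [L [sp px hp]] ha.
rewrite -px (horner_coef_wide _ sp); apply: le_trans (nrm_sum _ _ _) _.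
rewrite mulr_natl -[X in _ *+ X]card_ord -sumr_const; apply: ler_sum => k _.
rewrite expr1n mulr1 -ler_sqr ?nnegrE ?nrm_ge0 ?(Bd_ge0 ha) // -nrm_starM expr2.
have pa : Bd p`_k a.
  rewrite -(graded_component sp px hp (ltn_ord k)) -[a]mulr1 -[a]mul1r.
  apply: BdM; last by rewrite -(nrm_compressor (L + D) D.*2).
  by apply: BdM => //; rewrite -(nrm_compressor (L + k) D.*2) -nrm_star.
apply: (@nrm_core_le (L + D)); last by apply: BdM => //; apply: Bd_star.
by apply: (bihomM _ (hp k)); apply: bihom_star.
Qed.

Lemma nrm_star_poly_le x a : star_poly star s x -> Bd x a -> nrm x <= a.
Proof.
move=> hx ha; rewrite -ler_sqr ?nnegrE ?nrm_ge0 ?(Bd_ge0 ha) // -nrm_starM expr2.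
have yb : Bd (star x * x) (a * a) by apply: BdM => //; apply: Bd_star.
have [D hD] : exists D, graded D (star x * x).
  by apply: star_poly_graded; apply: sp_mul => //; apply: sp_star.
apply: (@Bd_selfadj _ _ (D.*2.+1)%:R) => //; first by rewrite starM starK.
move=> m; have hDm : graded (2 ^ m * D) ((star x * x) ^+ (2 ^ m)).
  elim: m => [|m IH]; first by rewrite expn0 expr1 mul1n.
  rewrite expnS -mulnA mul2n -addnn [(2 * _)%N]mulnC exprM expr2; exact: gradedM.
apply: le_trans (nrm_graded_le hDm (Bd_pow2 m yb)) _.
apply: ler_wpM2r; first by rewrite exprn_ge0 // mulr_ge0 // (Bd_ge0 ha).
by rewrite -natrM ler_nat; have := expn_gt0 2 m; lia.
Qed.

End NormUniqueness.

(** * Star endomorphisms are isometric with closed range *)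

Hypothesis s_dense : forall x, nclosure nrm (star_poly star s) x.

(** The pulled-back seminorm [nrm (alpha z)] is an instance of [Bd], with [Bd_nrm] given by
    contractivity; density passes from star polynomials to all of [A]. *)
Lemma star_endo_isometric alpha : unital_star_endo star alpha ->
  forall x, nrm (alpha x) = nrm x.
Proof.
move=> ha x; apply: le_anti; rewrite (star_endo_contractive ha) /=.
apply/ler_addgt0Pl => e e0; have [y [hy xy]] := s_dense x (divr_gt0 e0 (ltr0n _ 2)).
have y_le : nrm y <= nrm (alpha y).
  apply: (@nrm_star_poly_le (fun z a => nrm (alpha z) <= a)) => //.
  - by move=> z a; apply: le_trans; exact: nrm_ge0.
  - move=> z w a b za wb; rewrite (endoM ha); apply: le_trans (nrmM _ _) _.
    by rewrite ler_pM ?nrm_ge0.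
  - by move=> z a; rewrite (endo_star ha) nrm_star.
  - by move=> z; apply: star_endo_contractive.
  - by move=> c a; rewrite (endoZ ha) (endo1 ha) nrm_scalar.
have := nrm_le_dist x y; have := nrm_le_dist (alpha y) (alpha x).
rewrite nrm_distC -(endoB ha).
by have := star_endo_contractive ha (x - y); lra.
Qed.

Lemma star_endo_closed_image alpha (S : A -> Prop) y : unital_star_endo star alpha ->
  (forall e : R, 0 < e -> exists x, S x /\ nrm (y - alpha x) < e) ->
  exists x, nclosure nrm S x /\ alpha x = y.
Proof.
move=> ha hy.
have inv_gt0 k : 0 < (k.+1%:R : R)^-1 by rewrite invr_gt0 ltr0n.
have [u hu] := choice (fun k => hy _ (inv_gt0 k)).
have small e : 0 < e -> exists N, forall m, (N <= m)%N -> nrm (y - alpha (u m)) < e.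
  move=> e0; have [N hN] := archi_mul 1 e0; exists N => m Nm.
  apply: lt_trans (hu m).2 _; rewrite -[ltLHS]mulr1 mulrC ltr_pdivrMr ?ltr0n //.
  apply: lt_le_trans hN _; rewrite mulrC ler_pM2l // ler_nat.
  exact: leq_trans Nm (leqnSn m).
have [x hx] : exists x, lim_to u x.
  apply: (cs_complete hA) => e e0.
  have [N hN] := small _ (divr_gt0 e0 (ltr0n _ 2)).
  exists N => m k Nm Nk; rewrite -(star_endo_isometric ha) (endoB ha).
  apply: le_lt_trans (nrm_dist_triangle y _ _) _; rewrite nrm_distC.
  have := hN m Nm; have := hN k Nk; lra.
exists x; split.
  move=> e e0; have [N hN] := hx e e0; exists (u N); split; first exact: (hu N).1.
  by rewrite nrm_distC; apply: hN.
apply: (@lim_to_uniq (alpha \o u)).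
  move=> e /hx [N hN]; exists N => m /hN.
  by rewrite /= -(endoB ha) (star_endo_isometric ha).
by move=> e /small [N hN]; exists N => m /hN; rewrite nrm_distC.
Qed.

Lemma scalar_inj c d : c%:A = d%:A :> A -> c = d.
Proof.
move=> h; apply/eqP; rewrite -subr_eq0; apply/eqP/cabs_eq0.
by rewrite -nrm_scalar scalerBl h subrr nrm0.
Qed.

(** * The vacuum state as a limit of compressions by spikes *)

Definition spiked x N := star (spike N) * x * spike N.

Lemma spikedD x y N : spiked (x + y) N = spiked x N + spiked y N.
Proof. by rewrite /spiked mulrDr mulrDl. Qed.

Lemma spikedZ c x N : spiked (c *: x) N = c *: spiked x N.
Proof. by rewrite /spiked -scalerAr -scalerAl. Qed.

Lemma spikedB x y N : spiked (x - y) N = spiked x N - spiked y N.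
Proof. by rewrite -scaleN1r spikedD spikedZ scaleN1r. Qed.

Lemma spiked_star x N : spiked (star x) N = star (spiked x N).
Proof. by rewrite /spiked !starM starK mulrA. Qed.

Lemma nrm_spiked x N : nrm (spiked x N) <= nrm x.
Proof.
apply: le_trans (nrmM _ _) _; rewrite nrm_spike mulr1.
by apply: le_trans (nrmM _ _) _; rewrite nrm_star nrm_spike mul1r.
Qed.

Lemma spiked_bihom a b x : bihom a b x ->
  exists c, forall N, (maxn a b <= N)%N -> spiked x N = c%:A.
Proof.
move=> hx; have [c hc] := hx (nseq a i0) (nseq b i0) (size_nseq _ _) (size_nseq _ _).
exists (if a == b then c else 0) => N; rewrite geq_max => /andP[aN bN].
rewrite /spiked {1}(spike_split aN) (spike_split bN) starM.
have -> (p q r t y : A) : p * q * y * (r * t) = p * (q * y * r) * t by rewrite !mulrA.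
rewrite hc -scalerAr mulr1 -scalerAl; case: eqP => [->|ab]; first by rewrite spike_isom.
by rewrite spike_orth ?scaler0 ?scale0r //; apply/eqP; lia.
Qed.

Lemma spiked_star_poly x : star_poly star s x ->
  exists c N0, forall N, (N0 <= N)%N -> spiked x N = c%:A.
Proof.
move=> /star_poly_graded [D [p [L [sp <- hp]]]]; rewrite (horner_coef_wide _ sp).
elim/big_ind: _ => [|y z [c [N hN]] [d [M hM]]|k _].
- by exists 0, 0%N => N _; rewrite /spiked mulr0 mul0r scale0r.
- exists (c + d), (maxn N M) => K; rewrite geq_max => /andP[NK MK].
  by rewrite spikedD hN // hM // scalerDl.
have [c hc] := spiked_bihom (hp k); exists c, (maxn (L + k) (L + D)) => N /hc.
by rewrite expr1n mulr1.
Qed.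

(** On star polynomials the compressions are eventually a constant scalar. They are contractive, so
    density extends the convergence, and the limit stays scalar by completeness of [R[i]]. *)
Lemma spiked_cvg x : exists c, lim_to (spiked x) c%:A.
Proof.
have near e : 0 < e -> exists c N0, forall N, (N0 <= N)%N -> nrm (spiked x N - c%:A) < e.
  move=> e0; have [y [hy xy]] := s_dense x e0.
  have [c [N0 hc]] := spiked_star_poly hy; exists c, N0 => N NN.
  by rewrite -(hc N NN) -spikedB; apply: le_lt_trans (nrm_spiked _ _) xy.
have inv_gt0 k : 0 < (k.+1%:R : R)^-1 by rewrite invr_gt0 ltr0n.
have [u hu] := choice (fun k => near _ (inv_gt0 k)).
have small e : 0 < e -> exists K, forall m, (K <= m)%N ->
    exists N0, forall N, (N0 <= N)%N -> nrm (spiked x N - (u m)%:A) < e.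
  move=> e0; have [K hK] := archi_mul 1 e0; exists K => m Km.
  have [N0 hN0] := hu m; exists N0 => N /hN0 h; apply: lt_trans h _.
  rewrite -[ltLHS]mulr1 mulrC ltr_pdivrMr ?ltr0n //.
  apply: lt_le_trans hK _; rewrite mulrC ler_pM2l // ler_nat.
  exact: leq_trans Km (leqnSn m).
have [c hc] : exists c, forall e, 0 < e -> exists N, forall m, (N <= m)%N -> cabs (u m - c) < e.
  apply: complex_cauchy_cvg => e e0.
  have [K hK] := small _ (divr_gt0 e0 (ltr0n _ 2)); exists K => m k Km Kk.
  have [M hM] := hK m Km; have [M' hM'] := hK k Kk.
  rewrite -nrm_scalar scalerBl.
  apply: le_lt_trans (nrm_dist_triangle (spiked x (maxn M M')) _ _) _.
  rewrite nrm_distC; have := hM _ (leq_maxl M M'); have := hM' _ (leq_maxr M M'); lra.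
exists c => e e0; have e2 : 0 < e / 2 by rewrite divr_gt0.
have [K hK] := small _ e2; have [K' hK'] := hc _ e2.
have [N0 hN0] := hK _ (leq_maxl K K'); exists N0 => N /hN0 h.
apply: le_lt_trans (nrm_dist_triangle (u (maxn K K'))%:A _ _) _.
rewrite -scalerBl nrm_scalar; have := hK' _ (leq_maxr K K'); lra.
Qed.

(* A state of the algebra restricting to the vacuum state on the disk algebra. *)
Definition phi x : R[i] := projT1 (cid (spiked_cvg x)).

Lemma phi_lim x : lim_to (spiked x) (phi x)%:A.
Proof. exact: (projT2 (cid (spiked_cvg x))). Qed.

Lemma phi_eq x c : lim_to (spiked x) c%:A -> phi x = c.
Proof. by move=> h; apply: scalar_inj; apply: lim_to_uniq (phi_lim x) h. Qed.

Lemma phi_ev x c N0 : (forall N, (N0 <= N)%N -> spiked x N = c%:A) -> phi x = c.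
Proof.
by move=> h; apply: phi_eq => e e0; exists N0 => N /h ->; rewrite subrr nrm0.
Qed.

Lemma phiD x y : phi (x + y) = phi x + phi y.
Proof.
apply: phi_eq => e e0; have e2 : 0 < e / 2 by rewrite divr_gt0.
have [N hN] := phi_lim x e2; have [M hM] := phi_lim y e2; exists (maxn N M) => K.
rewrite geq_max => /andP[/hN h1 /hM h2]; rewrite spikedD scalerDl opprD addrACA.
by apply: le_lt_trans (nrmD _ _) _; lra.
Qed.

Lemma phiZ c x : phi (c *: x) = c * phi x.
Proof.
apply: phi_eq => e e0; have c1 : 0 < cabs c + 1 by rewrite ltr_wpDl ?cabs_ge0.
have [N hN] := phi_lim x (divr_gt0 e0 c1); exists N => K /hN.
rewrite spikedZ -scalerA -scalerBr nrmZ ltr_pdivlMr // => h.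
apply: le_lt_trans h; rewrite mulrC ler_wpM2l ?nrm_ge0 // lerDl //.
Qed.

Lemma phi_star x : phi (star x) = (phi x)^*.
Proof.
apply: phi_eq => e /(phi_lim x) [N hN]; exists N => K /hN.
have -> : ((phi x)^*)%:A = star (phi x)%:A by rewrite starZ star1.
by rewrite spiked_star -starB nrm_star.
Qed.

Lemma phi_le x : cabs (phi x) <= nrm x.
Proof.
apply/ler_addgt0Pl => e e0; have [N hN] := phi_lim x e0.
have := hN N (leqnn N); rewrite nrm_distC => h.
rewrite -nrm_scalar; apply: le_trans (nrm_le_dist _ (spiked x N)) _.
by have := nrm_spiked x N; lra.
Qed.

Lemma phi0 : phi 0 = 0. Proof. by have := phiZ 0 0; rewrite scale0r mul0r. Qed.

Lemma phiN x : phi (- x) = - phi x.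
Proof. by rewrite -scaleN1r phiZ mulN1r. Qed.

Lemma phiB x y : phi (x - y) = phi x - phi y.
Proof. by rewrite phiD phiN. Qed.

Lemma phi1 : phi 1 = 1.
Proof. by apply: (@phi_ev _ _ 0) => N _; rewrite /spiked mulr1 spike_isom scale1r. Qed.

Lemma phi_sw w : phi (sw w) = (w == [::])%:R.
Proof.
case: eqP => [->|w0]; first by rewrite sw_nil phi1.
apply: (@phi_ev _ _ (size w)) => N wN; rewrite scale0r /spiked.
by apply: (spike_kill (@bihom_sw w)); rewrite wN andbT lt0n size_eq0; apply/eqP.
Qed.

Lemma sw_div u w : (size u <= size w)%N ->
  star (sw u) * sw w = (u == take (size u) w)%:R * sw (drop (size u) w).
Proof.
move=> uw; rewrite -{1}(cat_take_drop (size u) w) sw_cat mulrA sw_orth //.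
by rewrite size_take_min; exact/esym/minn_idPl.
Qed.

Lemma phi_orth u w : phi (star (sw u) * sw w) = (u == w)%:R.
Proof.
suff le a b : (size a <= size b)%N -> phi (star (sw a) * sw b) = (a == b)%:R.
  case: (leqP (size u) (size w)) => [/le //|/ltnW /le h].
  by rewrite -[sw w]starK -starM phi_star h rmorph_nat eq_sym.
move=> ab; rewrite sw_div //; case: eqP => [e|ne]; last first.
  rewrite mul0r phi0; case: eqP => // eab; case: ne.
  by rewrite -eab take_size.
rewrite mul1r phi_sw -size_eq0 size_drop subn_eq0; congr (nat_of_bool _)%:R.
apply/idP/eqP => [ba|->]; last exact: leqnn.
by rewrite e take_oversize.
Qed.

Lemma alg_poly_ind_words (Q : A -> Prop) :
  (forall x y, Q x -> Q y -> Q (x + y)) -> (forall c x, Q x -> Q (c *: x)) ->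
  (forall w, Q (sw w)) -> forall x, alg_poly s x -> Q x.
Proof.
move=> QD QZ Qw x hx.
(* [Q] stays general because the product case applies the two hypotheses to [fun z => Q (z * y)] and
   [fun z => Q (sw w * z)]. *)
elim: hx Q QD QZ Qw => {x} [i||x y _ IHx _ IHy|c x _ IHx|x y _ IHx _ IHy] Q QD QZ Qw.
- by rewrite -sw_seq1.
- by rewrite -sw_nil.
- exact: (QD _ _ (IHx Q QD QZ Qw) (IHy Q QD QZ Qw)).
- exact: (QZ _ _ (IHx Q QD QZ Qw)).
apply: (IHx (fun z => Q (z * y))) => [z t|c z|w].
- by rewrite mulrDl; apply: QD.
- by rewrite -scalerAl; apply: QZ.
apply: (IHy (fun z => Q (sw w * z))) => [z t|c z|u].
- by rewrite mulrDr; apply: QD.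
- by rewrite -scalerAr; apply: QZ.
by rewrite -sw_cat.
Qed.

(** * The disk algebra and bounded functionals on it *)

Local Notation disk := (disk_algebra nrm s).

Lemma disk_poly x : alg_poly s x -> disk x.
Proof. by move=> hx e e0; exists x; rewrite subrr nrm0. Qed.

Lemma alg_poly_sw w : alg_poly s (sw w).
Proof.
elim: w => [|i w IH]; first by rewrite sw_nil; exact: ap_one.
by rewrite sw_cons; apply: ap_mul => //; exact: ap_gen.
Qed.

Lemma disk_sw w : disk (sw w).
Proof. exact/disk_poly/alg_poly_sw. Qed.

Lemma disk_gen i : disk (s i).
Proof. exact/disk_poly/ap_gen. Qed.

Lemma disk1 : disk 1.
Proof. exact/disk_poly/ap_one. Qed.

Lemma diskD x y : disk x -> disk y -> disk (x + y).
Proof.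
move=> hx hy e e0; have e2 : 0 < e / 2 by rewrite divr_gt0.
have [p [hp xp]] := hx _ e2; have [q [hq yq]] := hy _ e2.
exists (p + q); split; first exact: ap_add.
by rewrite opprD addrACA; apply: le_lt_trans (nrmD _ _) _; lra.
Qed.

Lemma diskZ c x : disk x -> disk (c *: x).
Proof.
move=> hx e e0; have c1 : 0 < cabs c + 1 by rewrite ltr_wpDl ?cabs_ge0.
have [p [hp xp]] := hx _ (divr_gt0 e0 c1); exists (c *: p); split; first exact: ap_scale.
rewrite -scalerBr nrmZ; move: xp; rewrite ltr_pdivlMr // => h.
by apply: le_lt_trans h; rewrite mulrC ler_wpM2l ?nrm_ge0 // lerDl.
Qed.

Lemma diskB x y : disk x -> disk y -> disk (x - y).
Proof. by move=> hx hy; rewrite -scaleN1r; apply: diskD => //; apply: diskZ. Qed.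

Lemma diskM x y : disk x -> disk y -> disk (x * y).
Proof.
move=> hx hy e e0; pose K := nrm x + nrm y + 1.
have K0 : 0 < K by rewrite ltr_wpDl ?addr_ge0 ?nrm_ge0.
pose d := Num.min 1 (e / K).
have d0 : 0 < d by rewrite lt_min ltr01 divr_gt0.
have d1 : d <= 1 by rewrite ge_min lexx.
have de : d * K <= e by rewrite -ler_pdivlMr // ge_min lexx orbT.
have [p [hp xp]] := hx _ d0; have [q [hq yq]] := hy _ d0.
exists (p * q); split; first exact: ap_mul.
have -> : x * y - p * q = (x - p) * y + p * (y - q) by rewrite mulrBl mulrBr addrA subrK.
apply: le_lt_trans (nrmD _ _) _; apply: le_lt_trans (lerD (nrmM _ _) (nrmM _ _)) _.
apply: lt_le_trans de; have px : nrm p <= nrm x + 1.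
  by apply: le_trans (nrm_le_dist p x) _; rewrite lerD2l nrm_distC; lra.
have h1 : nrm (x - p) * nrm y <= d * nrm y by rewrite ler_wpM2r ?nrm_ge0 // ltW.
have h2 : nrm p * nrm (y - q) <= (nrm x + 1) * nrm (y - q) by rewrite ler_wpM2r ?nrm_ge0.
have h3 : (nrm x + 1) * nrm (y - q) < (nrm x + 1) * d.
  by rewrite ltr_pM2l // ltr_wpDl ?nrm_ge0.
by rewrite /K; lra.
Qed.

Lemma disk0 : disk 0. Proof. by rewrite -(scale0r 1); apply: diskZ; exact: disk1. Qed.

Lemma disk_sum (I : Type) (r : seq I) (P : pred I) (F : I -> A) :
  (forall i, P i -> disk (F i)) -> disk (\sum_(i <- r | P i) F i).
Proof. by move=> h; elim/big_ind: _ => //; [exact: disk0 | exact: diskD]. Qed.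

Lemma disk_closed x : nclosure nrm disk x -> disk x.
Proof.
move=> hx e e0; have e2 : 0 < e / 2 by rewrite divr_gt0.
have [y [hy xy]] := hx _ e2; have [p [hp yp]] := hy _ e2; exists p; split=> //.
by apply: le_lt_trans (nrm_dist_triangle y _ _) _; lra.
Qed.

Definition bounded_functional (F : A -> R[i]) := [/\ forall x y, F (x + y) = F x + F y,
  forall c x, F (c *: x) = c * F x & exists K : R, forall x, cabs (F x) <= K * nrm x].

(** The transfer principle from words to [disk]: an identity linear and bounded in one argument need
    only be checked on words. *)
Lemma disk_functional0 F : bounded_functional F ->
  (forall w, F (sw w) = 0) -> forall x, disk x -> F x = 0.
Proof.
case=> FD FZ [K FK] Fw x hx; apply: cabs_eq0; apply: le_anti; rewrite cabs_ge0 andbT.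
apply/ler_addgt0Pl => e e0; rewrite addr0.
have K1 : 0 < `|K| + 1 by rewrite ltr_wpDl.
have [p [hp xp]] := hx _ (divr_gt0 e0 K1).
have Fp : F p = 0.
  apply: (alg_poly_ind_words (Q := fun z => F z = 0)) hp => // [z t z0 t0|c z z0].
    by rewrite FD z0 t0 addr0.
  by rewrite FZ z0 mulr0.
rewrite -[x](subrK p) FD Fp addr0; apply: le_trans (FK _) _.
move: xp; rewrite ltr_pdivlMr // => h; apply: le_trans (ltW h).
rewrite mulrC ler_wpM2l ?nrm_ge0 // (le_trans (ler_norm K)) // lerDl //.
Qed.

Lemma bounded_functional_phi u v : bounded_functional (fun x => phi (u * x * v)).
Proof.
split=> [x y|c x|]; first by rewrite mulrDr mulrDl phiD.
  by rewrite -scalerAr -scalerAl phiZ.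
exists (nrm u * nrm v) => x; apply: le_trans (phi_le _) _.
apply: le_trans (nrmM _ _) _; rewrite mulrAC ler_wpM2r ?nrm_ge0 //.
exact: nrmM.
Qed.

Lemma bounded_functionalB F G : bounded_functional F -> bounded_functional G ->
  bounded_functional (fun x => F x - G x).
Proof.
case=> FD FZ [K FK] [GD GZ [L GL]]; split=> [x y|c x|].
- by rewrite FD GD opprD addrACA.
- by rewrite FZ GZ mulrBr.
exists (K + L) => x; rewrite mulrDl; apply: le_trans (cabsD _ _) _.
by rewrite cabsN lerD.
Qed.

Lemma bounded_functionalZ c F : bounded_functional F -> bounded_functional (fun x => c * F x).
Proof.
case=> FD FZ [K FK]; split=> [x y|d x|]; first by rewrite FD mulrDr.
  by rewrite FZ mulrCA.
exists (cabs c * K) => x; rewrite cabsM -mulrA ler_wpM2l ?cabs_ge0 //.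
Qed.

(** * The vacuum inner product, Bessel and Parseval *)

Definition ip x y := phi (star y * x).

Lemma ip_conj x y : (ip x y)^* = ip y x.
Proof. by rewrite /ip -phi_star starM starK. Qed.

Lemma ipDl x y z : ip (x + y) z = ip x z + ip y z.
Proof. by rewrite /ip mulrDr phiD. Qed.

Lemma ipZl c x z : ip (c *: x) z = c * ip x z.
Proof. by rewrite /ip -scalerAr phiZ. Qed.

Lemma ip0l z : ip 0 z = 0. Proof. by rewrite /ip mulr0 phi0. Qed.

Lemma ipBl x y z : ip (x - y) z = ip x z - ip y z.
Proof. by rewrite /ip mulrBr phiB. Qed.

Lemma ipDr x y z : ip z (x + y) = ip z x + ip z y.
Proof. by rewrite /ip starD mulrDl phiD. Qed.

Lemma ipBr x y z : ip z (x - y) = ip z x - ip z y.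
Proof. by rewrite /ip starB mulrBl phiB. Qed.

Lemma ipZr c x z : ip z (c *: x) = c^* * ip z x.
Proof. by rewrite /ip starZ -scalerAl phiZ. Qed.

Lemma ip_suml (I : Type) (r : seq I) (P : pred I) (F : I -> A) z :
  ip (\sum_(i <- r | P i) F i) z = \sum_(i <- r | P i) ip (F i) z.
Proof. exact: (big_morph (ip^~ z) (fun x y => ipDl x y z) (ip0l z)). Qed.

Lemma ip_sumr (I : Type) (r : seq I) (P : pred I) (F : I -> A) z :
  ip z (\sum_(i <- r | P i) F i) = \sum_(i <- r | P i) ip z (F i).
Proof.
by rewrite -ip_conj ip_suml rmorph_sum /=; apply: eq_bigr => i _; rewrite ip_conj.
Qed.

Lemma ip_adj z x y : ip (z * x) y = ip x (star z * y).
Proof. by rewrite /ip starM starK mulrA. Qed.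

Lemma bounded_functional_ip u v y : bounded_functional (fun x => ip (u * x * v) y).
Proof.
have := bounded_functional_phi (star y * u) v; congr bounded_functional; apply/funext => x.
by rewrite /ip !mulrA.
Qed.

Lemma ip_words u w : ip (sw u) (sw w) = (u == w)%:R.
Proof. by rewrite /ip phi_orth eq_sym. Qed.

(** Right multiplication appends a letter to the orthonormal words, hence is isometric, with
    orthogonal ranges for different letters; the transfer from words is made in each argument
    separately. *)
Lemma ip_right_shift x y i j : disk x -> disk y ->
  ip (x * s i) (y * s j) = (i == j)%:R * ip x y.
Proof.
have base u z : disk z -> ip (z * s i) (sw u * s j) = (i == j)%:R * ip z (sw u).
  move=> hz; apply/eqP; rewrite -subr_eq0; apply/eqP.
  pose F t := ip (1 * t * s i) (sw u * s j) - (i == j)%:R * ip (1 * t * 1) (sw u).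
  have := @disk_functional0 F; rewrite /F => /(_ _ _ z hz); rewrite mulr1 mul1r; apply.
    by apply: bounded_functionalB; [exact: bounded_functional_ip |]; apply/bounded_functionalZ/bounded_functional_ip.
  move=> w; rewrite mul1r mulr1 -!sw_rcons !ip_words eqseq_rcons andbC.
  by case: (i == j); rewrite ?mul1r ?mul0r subrr.
move=> hx hy; rewrite -[RHS]conjCK rmorphM /= rmorph_nat ip_conj -ip_conj; congr (_ ^*).
apply/eqP; rewrite -subr_eq0; apply/eqP.
pose F t := ip (1 * t * s j) (x * s i) - (i == j)%:R * ip (1 * t * 1) x.
have := @disk_functional0 F; rewrite /F => /(_ _ _ y hy); rewrite mulr1 mul1r; apply.
  by apply: bounded_functionalB; [exact: bounded_functional_ip |]; apply/bounded_functionalZ/bounded_functional_ip.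
move=> w; rewrite mul1r mulr1 -[X in X - _]ip_conj base // rmorphM /= rmorph_nat ip_conj.
by rewrite subrr.
Qed.

Definition nr2 x : R := complex.Re (ip x x).

Lemma ipxx x : ip x x = (nr2 x)%:C%C.
Proof.
rewrite /nr2; have := ip_conj x x; case: (ip x x) => a b [] h.
by congr (_ +i* _)%C; lra.
Qed.

Lemma nr2_le x : nr2 x <= nrm x ^+ 2.
Proof.
apply: le_trans (ler_norm _) _; apply: le_trans (Re_le_cabs _) _.
by apply: le_trans (phi_le _) _; rewrite nrm_starM.
Qed.

Definition trunc m x := \sum_(k < m) \sum_(w <- words k) ip x (sw w) *: sw w.

Definition energy m x : R := \sum_(k < m) \sum_(w <- words k) cabs (ip x (sw w)) ^+ 2.

Lemma energy_ge0 m x : 0 <= energy m x.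
Proof. by apply: sumr_ge0 => k _; apply: sumr_ge0 => w _; rewrite sqr_ge0. Qed.

Lemma truncD m x y : trunc m (x + y) = trunc m x + trunc m y.
Proof.
rewrite -big_split; apply: eq_bigr => k _; rewrite -big_split; apply: eq_bigr => w _ /=.
by rewrite ipDl scalerDl.
Qed.

Lemma truncZ m c x : trunc m (c *: x) = c *: trunc m x.
Proof.
rewrite scaler_sumr; apply: eq_bigr => k _; rewrite scaler_sumr; apply: eq_bigr => w _.
by rewrite ipZl scalerA.
Qed.

Lemma trunc_sw m w : (size w < m)%N -> trunc m (sw w) = sw w.
Proof.
move=> wm; rewrite -[RHS](big_words_lt_delta sw wm); apply: eq_bigr => k _.
apply: eq_bigr => u _; rewrite ip_words [in RHS]eq_sym.
by case: (w == u); rewrite ?scale1r ?mul1r ?scale0r ?mul0r.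
Qed.

Lemma trunc_poly x : alg_poly s x -> exists m0, forall m, (m0 <= m)%N -> trunc m x = x.
Proof.
move: x; apply: alg_poly_ind_words => [y z [m hm] [k hk]|c y [m hm]|w].
- by exists (maxn m k) => l; rewrite geq_max => /andP[/hm h1 /hk h2]; rewrite truncD h1 h2.
- by exists m => l /hm h; rewrite truncZ h.
- by exists (size w).+1 => l; apply: trunc_sw.
Qed.

Lemma ip_trunc m x w : (size w < m)%N -> ip (trunc m x) (sw w) = ip x (sw w).
Proof.
move=> wm; rewrite -(big_words_lt_delta (fun u => ip x (sw u)) wm) ip_suml.
apply: eq_bigr => k _; rewrite ip_suml; apply: eq_bigr => u _.
by rewrite ipZl ip_words mulrC.
Qed.

Lemma nr2_trunc m x : nr2 (x - trunc m x) = nr2 x - energy m x.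
Proof.
have E : (energy m x)%:C%C = ip (trunc m x) x.
  rewrite ip_suml rmorph_sum; apply: eq_bigr => k _; rewrite ip_suml rmorph_sum.
  by apply: eq_bigr => w _; rewrite ipZl -(ip_conj x) /= cabs_sqr mulrC.
have E' : (energy m x)%:C%C = ip x (trunc m x).
  by rewrite -ip_conj -E; apply/esym/CrealP; rewrite realE ler0c energy_ge0.
have Et : (energy m x)%:C%C = ip (trunc m x) (trunc m x).
  rewrite {2}/trunc ip_sumr E'; rewrite {2}/trunc ip_sumr; apply: eq_bigr => k _.
  rewrite !ip_sumr big_seq [RHS]big_seq; apply: eq_bigr => w; rewrite mem_words => /eqP wk.
  by rewrite !ipZr ip_trunc // wk.
apply: complexI; rewrite -ipxx ipBl !ipBr -E' -E -Et subrr subr0 rmorphB /=.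
by rewrite ipxx.
Qed.

(** A polynomial equals its own truncation of high order, so its [nr2] is a sum of squares;
    continuity carries the sign over to [disk]. *)
Lemma nr2_ge0 x : disk x -> 0 <= nr2 x.
Proof.
(* [nr2] changes by at most [d * K] between [x] and an approximant within [d <= 1]. *)
move=> hx; apply/ler_addgt0Pl => e e0.
pose K := 2 * nrm x + 1; have K0 : 0 < K by rewrite ltr_wpDl // mulr_ge0 // nrm_ge0.
pose d := Num.min 1 (e / K).
have d0 : 0 < d by rewrite lt_min ltr01 divr_gt0.
have d1 : d <= 1 by rewrite ge_min lexx.
have de : d * K <= e by rewrite -ler_pdivlMr // ge_min lexx orbT.
have [p [hp xp]] := hx _ d0.
have p0 : 0 <= nr2 p.
  have [m hm] := trunc_poly hp; have := nr2_trunc m p.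
  rewrite hm // subrr {1}/nr2 ip0l /= => /eqP; rewrite eq_sym subr_eq0 => /eqP ->.
  exact: energy_ge0.
have dist : `|nr2 p - nr2 x| <= nrm (x - p) * nrm x + nrm p * nrm (x - p).
  rewrite distrC /nr2 -raddfB; apply: le_trans (Re_le_cabs _) _.
  rewrite -phiB; apply: le_trans (phi_le _) _.
  have -> : star x * x - star p * p = star (x - p) * x + star p * (x - p).
    by rewrite starB mulrBl mulrBr addrA subrK.
  apply: le_trans (nrmD _ _) _; apply: le_trans (lerD (nrmM _ _) (nrmM _ _)) _.
  by rewrite !nrm_star.
move: dist; rewrite ler_distl => /andP[_ h].
have px : nrm p <= nrm x + 1.
  by apply: le_trans (nrm_le_dist p x) _; rewrite lerD2l nrm_distC; lra.
have h2 : nrm p * nrm (x - p) <= (nrm x + 1) * nrm (x - p) by rewrite ler_wpM2r ?nrm_ge0.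
have h3 : nrm (x - p) * K <= d * K by rewrite ler_wpM2r ?ltW.
by move: h3; rewrite {1}/K; lra.
Qed.

Lemma disk_trunc m x : disk (trunc m x).
Proof.
by apply: disk_sum => k _; apply: disk_sum => w _; apply: diskZ; exact: disk_sw.
Qed.

Lemma bessel m x : disk x -> energy m x <= nr2 x.
Proof.
move=> hx; rewrite -subr_ge0 -nr2_trunc; apply: nr2_ge0.
by apply: diskB => //; exact: disk_trunc.
Qed.

Lemma parseval x e : disk x -> 0 < e ->
  exists m0, forall m, (m0 <= m)%N -> nr2 x - e < energy m x.
Proof.
move=> hx e0; pose d := Num.min 1 e.
have d0 : 0 < d by rewrite lt_min ltr01.
have d1 : d <= 1 by rewrite ge_min lexx.
have de : d <= e by rewrite ge_min lexx orbT.
have [p [hp xp]] := hx _ d0; have [m0 hm] := trunc_poly hp; exists m0 => m /hm tp.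
have : nr2 x - energy m x <= nrm (x - p) ^+ 2.
  (* [p] is fixed by truncation, so the truncation error of [x] is that of [x - p]. *)
  rewrite -nr2_trunc -[in X in X - _](subrK p x) -[in X in trunc _ X](subrK p x) truncD tp.
  rewrite opprD addrACA subrr addr0 nr2_trunc.
  by apply: le_trans (nr2_le _); rewrite gerBl energy_ge0.
have : nrm (x - p) ^+ 2 <= nrm (x - p) by rewrite expr2 ler_piMl ?nrm_ge0 //; lra.
by lra.
Qed.

Lemma ip_right_shift1 x i : disk x -> ip (x * s i) 1 = 0.
Proof.
move=> hx; have := @disk_functional0 _ (bounded_functional_ip 1 (s i) 1) _ x hx.
rewrite mul1r; apply=> w.
by rewrite mul1r -sw_rcons -sw_nil ip_words; case: w.
Qed.

Lemma nr2_pyth x y : ip x y = 0 -> nr2 (x + y) = nr2 x + nr2 y.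
Proof.
move=> h; have h' : ip y x = 0 by rewrite -ip_conj h conjC0.
by rewrite /nr2 ipDl !ipDr h h' addr0 add0r raddfD.
Qed.

Lemma nr2Z c x : nr2 (c *: x) = cabs c ^+ 2 * nr2 x.
Proof.
by apply: complexI; rewrite -ipxx ipZl ipZr mulrA [c * _]mulrC -cabs_sqr ipxx -rmorphM.
Qed.

Lemma nr2_proj x y : nr2 y != 0 ->
  nr2 (x - (ip x y / (nr2 y)%:C%C) *: y) = nr2 x - cabs (ip x y) ^+ 2 / nr2 y.
Proof.
move=> y0; set c := _ / _.
have y0' : ((nr2 y)%:C)%C != 0 :> R[i].
  by apply: contra y0 => /eqP h; apply/eqP/complexI.
have orth : ip (x - c *: y) (c *: y) = 0.
  by rewrite ipZr ipBl ipZl ipxx /c divfK // subrr mulr0.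
have := nr2_pyth orth; rewrite subrK => ->; rewrite nr2Z /c cabsM cabsV cabsR.
rewrite exprMn exprVn real_normK ?num_real //; field.
exact: y0.
Qed.

(** * Null vectors of the vacuum form and faithfulness *)

Lemma disk_coef0 x : (forall w, ip x (sw w) = 0) -> forall y, disk y -> ip x y = 0.
Proof.
move=> hx y hy; rewrite -ip_conj; have := @disk_functional0 _ (bounded_functional_ip 1 1 x) _ y hy.
by rewrite mul1r mulr1 => ->; rewrite ?conjC0 // => w; rewrite mul1r mulr1 -ip_conj hx conjC0.
Qed.

Lemma nr2_eq0_ip x y : disk x -> nr2 x = 0 -> disk y -> ip x y = 0.
Proof.
move=> hx x0; apply: disk_coef0 => w.
have w1 : nr2 (sw w) = 1 by rewrite /nr2 ip_words eqxx.
have w0 : nr2 (sw w) != 0 by rewrite w1 oner_eq0.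
have : 0 <= nr2 x - cabs (ip x (sw w)) ^+ 2 / nr2 (sw w).
  rewrite -nr2_proj //; apply: nr2_ge0.
  by apply: diskB => //; apply: diskZ; exact: disk_sw.
rewrite x0 w1 divr1 sub0r oppr_ge0 => h; apply: cabs_eq0; apply/eqP.
by rewrite -sqrf_eq0; apply/eqP/le_anti; rewrite h sqr_ge0.
Qed.

(** If [x] kills the vacuum, it kills every vector that [disk] produces from the vacuum: on words
    this is an induction on last letters, because right multiplication preserves inner products. *)
Lemma nr2_eq0_mul x y : disk x -> nr2 x = 0 -> disk y -> nr2 (x * y) = 0.
Proof.
move=> hx x0 hy; rewrite /nr2 (@disk_coef0 (x * y)) //; last exact: diskM.
move=> w; have := @disk_functional0 _ (bounded_functional_ip x 1 (sw w)) _ y hy.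
rewrite mulr1; apply.
move=> u; rewrite mulr1; elim/last_ind: u w => [|u k IH] w.
  by rewrite sw_nil mulr1; apply: nr2_eq0_ip => //; exact: disk_sw.
have xu : disk (x * sw u) by apply: diskM => //; exact: disk_sw.
rewrite sw_rcons mulrA; case/lastP: w => [|w j]; first by rewrite sw_nil ip_right_shift1.
by rewrite sw_rcons ip_right_shift //; [rewrite IH mulr0 | exact: disk_sw].
Qed.

(** A long enough power of [s i0] on the right absorbs every [s_w^*]. *)
Lemma star_poly_shift_disk z : star_poly star s z -> exists N, disk (z * sw (nseq N i0)).
Proof.
move=> /star_poly_graded [D [p [L [sp <- hp]]]]; exists (L + D)%N.
rewrite (horner_coef_wide _ sp) mulr_suml; apply: disk_sum => k _.
rewrite expr1n mulr1 -[p`_k]mul1r -(words_unit (L + k)) !mulr_suml big_seq.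
apply: disk_sum => u; rewrite mem_words => /eqP uk.
have [c hc] := hp k u _ uk (size_nseq _ i0).
have -> (a b d e : A) : a * b * d * e = a * (b * d * e) by rewrite !mulrA.
by rewrite hc -scalerAr mulr1; apply: diskZ; exact: disk_sw.
Qed.

(** The elements [z * spike N] play the part of [z] applied to the vacuum. Splitting off a power of
    [i0] that brings an approximant of [z] into [disk] reduces the claim to [nr2_eq0_mul]. *)
Lemma nr2_eq0_spike x z e : disk x -> nr2 x = 0 -> 0 < e ->
  exists N0, forall N, (N0 <= N)%N -> nrm (x * z * spike N) < e.
Proof.
move=> hx x0 e0; have e2 : 0 < e / 2 by rewrite divr_gt0.
have x1 : 0 < nrm x + 1 by rewrite ltr_wpDl ?nrm_ge0.
have [y [hy zy]] := s_dense z (divr_gt0 e2 x1).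
have [M hM] := star_poly_shift_disk hy.
pose t := x * (y * sw (nseq M i0)).
have t0 : phi (star t * t) = 0 by rewrite -/(ip t t) ipxx nr2_eq0_mul.
have [K hK] := phi_lim (star t * t) (mulr_gt0 e2 e2).
exists (M + K)%N => N NM; have MN : (M <= N)%N by rewrite (leq_trans _ NM) // leq_addr.
have : nrm (t * spike (N - M)) < e / 2.
  rewrite -(@ltr_pXn2r _ 2) ?nnegrE ?nrm_ge0 ?(ltW e2) // -nrm_starM starM.
  have := hK (N - M)%N; rewrite leq_subRL // NM => /(_ isT).
  by rewrite t0 scale0r subr0 /spiked expr2 !mulrA.
rewrite /t -!mulrA -(spike_split MN) [x * (y * _)]mulrA => h.
rewrite -[z](subrK y) mulrDl mulrDr ![x * (_ * _)]mulrA; apply: le_lt_trans (nrmD _ _) _.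
suff : nrm (x * (z - y) * spike N) < e / 2 by move: h; lra.
apply: le_lt_trans (nrmM _ _) _; rewrite nrm_spike mulr1.
apply: le_lt_trans (nrmM _ _) _; move: zy; rewrite ltr_pdivlMr // => zy.
by apply: le_lt_trans zy; rewrite mulrC ler_wpM2l ?nrm_ge0 // lerDl.
Qed.

(** An upper bound for the norm of left multiplication by [x] on the asymptotic vectors
    [z * spike N], which model the vacuum representation. *)
Definition spike_bounded x (a : R) := forall z e, 0 < e ->
  exists N0, forall N, (N0 <= N)%N -> nrm (x * z * spike N) <= a * nrm (z * spike N) + e.

Lemma spike_boundedM x y a b : 0 <= a -> spike_bounded x a -> spike_bounded y b ->
  spike_bounded (x * y) (a * b).
Proof.
move=> a0 hx hy z e e0; have e2 : 0 < e / 2 by rewrite divr_gt0.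
have a1 : 0 < a + 1 by rewrite ltr_wpDl.
have [N hN] := hx (y * z) _ e2; have [M hM] := hy z _ (divr_gt0 e2 a1).
exists (maxn N M) => K; rewrite geq_max => /andP[/hN h1 /hM h2].
rewrite -[x * y * z]mulrA; apply: le_trans h1 _.
have : a * nrm (y * z * spike K) <= a * (b * nrm (z * spike K) + e / 2 / (a + 1)).
  exact: ler_wpM2l.
have : a * (e / 2 / (a + 1)) <= e / 2.
  by rewrite mulrA ler_pdivrMr // mulrC ler_wpM2l ?(ltW e2) // lerDl.
by rewrite mulrDr mulrA; lra.
Qed.

(* The vacuum representation is faithful on the disk algebra: it defines a second
   C*-seminorm, to which [nrm_star_poly_le] applies. *)
Lemma nr2_faithful x : disk x -> nr2 x = 0 -> x = 0.
Proof.
move=> hx x0; apply: nrm_eq0; rewrite -ler_sqr ?nnegrE ?nrm_ge0 // expr0n /= -nrm_starM.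
set h := star x * x; have hs : star h = h by rewrite /h starM starK.
have h0 z e : 0 < e -> exists N0, forall N, (N0 <= N)%N -> nrm (h * z * spike N) < e.
  move=> e0; have x1 : 0 < nrm x + 1 by rewrite ltr_wpDl ?nrm_ge0.
  have [N0 hN] := nr2_eq0_spike z hx x0 (divr_gt0 e0 x1); exists N0 => N /hN.
  rewrite ltr_pdivlMr // => hh; apply: le_lt_trans hh.
  rewrite /h -!mulrA; apply: le_trans (nrmM _ _) _; rewrite nrm_star mulrC.
  by rewrite ler_wpM2l ?nrm_ge0 // lerDl.
apply/ler_addgt0Pl => e e0; rewrite addr0; have e2 : 0 < e / 2 by rewrite divr_gt0.
have [p [hp hpe]] := s_dense h e2.
suff : nrm p <= e / 2 by have := nrm_le_dist h p; lra.
(* [h] acts as zero on the asymptotic vectors, so [q] acts like [q - h]. *)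
have near q : nrm (h - q) < e / 2 -> spike_bounded q (e / 2).
  move=> hq z d d0; have [N0 hN] := h0 z d d0; exists N0 => N /hN hh.
  rewrite -[q](subKr h) mulrBl mulrBl addrC; apply: le_trans (nrmD _ _) _.
  rewrite nrmN -[(h - q) * z * _]mulrA; apply: lerD (ltW hh).
  apply: le_trans (nrmM _ _) _; rewrite ler_wpM2r ?nrm_ge0 //; exact: ltW.
apply: (@nrm_star_poly_le (fun y a => [/\ 0 <= a, spike_bounded y a & spike_bounded (star y) a])).
- by move=> y a [].
- move=> y z a b [a0 h1 h2] [b0 h3 h4]; split; first exact: mulr_ge0.
    exact: spike_boundedM.
  by rewrite starM mulrC; apply: spike_boundedM.
- by move=> y a [a0 h1 h2]; split=> //; rewrite starK.
- have bd y a : nrm y <= a -> spike_bounded y a.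
    move=> ya z d d0; exists 0%N => N _; rewrite -mulrA; apply: le_trans (nrmM _ _) _.
    by rewrite ler_wpDr ?(ltW d0) // ler_wpM2r ?nrm_ge0.
  by move=> y; split; [exact: nrm_ge0 | exact: bd | apply: bd; rewrite nrm_star].
- move=> c a [_ hc _]; apply/ler_addgt0Pr => d /(hc 1) [N0 /(_ _ (leqnn N0))].
  by rewrite mulr1 mul1r -scalerAl mul1r nrmZ nrm_spike !mulr1.
- exact: hp.
split; [exact: ltW | exact: near | apply: near].
by rewrite -hs -starB nrm_star.
Qed.

(** * Residuals of words modulo the range of the isometries [v] *)

Section DiskIsometries.
Variable v : 'I_n -> A.
Hypothesis v_disk : forall j, disk (v j).
Hypothesis v_orth : forall i j, star (v i) * v j = (i == j)%:R.
Hypothesis v_sum : \sum_j v j * star (v j) = 1.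

Definition fcoef j w := ip (v j) (sw w).

(* The orthogonal projection of [sw w] onto the complement of [sum_j v_j A_n]; the recursion
   runs over the reversed word, since right multiplication is what commutes with the [v_j]. *)
Fixpoint residual_rev (w : seq 'I_n) : A :=
  if w is i :: w' then residual_rev w' * s i - \sum_j (fcoef j (rev w))^* *: v j
  else 1 - \sum_j (fcoef j [::])^* *: v j.

Definition residual w := residual_rev (rev w).

Lemma residual_nil : residual [::] = 1 - \sum_j (fcoef j [::])^* *: v j.
Proof. by []. Qed.

Lemma residual_rcons w i :
  residual (rcons w i) = residual w * s i - \sum_j (fcoef j (rcons w i))^* *: v j.
Proof. by rewrite /residual rev_rcons /= rev_cons revK. Qed.

Definition v_range z := exists b : 'I_n -> A, (forall j, disk (b j)) /\ z = \sum_j v j * b j.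

Lemma v_range_disk z : v_range z -> disk z.
Proof. by case=> b [hb ->]; apply: disk_sum => j _; exact: diskM. Qed.

Lemma sw_residual w : v_range (sw w - residual w).
Proof.
elim/last_ind: w => [|w i [b [hb hw]]].
  exists (fun j => (fcoef j [::])^* *: 1); split=> [j|].
    by apply: diskZ; exact: disk1.
  rewrite residual_nil sw_nil opprB addrC subrK; apply: eq_bigr => j _.
  by rewrite -scalerAr mulr1.
exists (fun j => b j * s i + (fcoef j (rcons w i))^* *: 1); split=> [j|].
  apply: diskD; first by apply: diskM => //; exact: disk_gen.
  by apply: diskZ; exact: disk1.
rewrite residual_rcons sw_rcons opprB addrCA -mulrBl hw mulr_suml -big_split /=.
by apply: eq_bigr => j _; rewrite mulrDr mulrA -scalerAr mulr1 addrC.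
Qed.

Lemma disk_residual w : disk (residual w).
Proof.
rewrite -[residual w](subKr (sw w)); apply: diskB; first exact: disk_sw.
exact/v_range_disk/sw_residual.
Qed.

Lemma ip_v_comb j u (c : 'I_n -> R[i]) :
  ip (v j * sw u) (\sum_k (c k)^* *: v k) = c j * (u == [::])%:R.
Proof.
have one : true%:R = sw [::] by rewrite sw_nil.
rewrite ip_sumr (bigD1 j) //= ipZr conjCK ip_adj v_orth eqxx one ip_words big1 ?addr0 // => k kj.
by rewrite ipZr ip_adj v_orth eq_sym (negPf kj) /ip mulr0n star0 mul0r phi0 mulr0.
Qed.

(** By induction on last letters only the pairing with [v j] itself is new. There the range element
    separating [residual w] from [sw w] contributes nothing after right multiplication by [s i], so
    the pairing is [fcoef j (rcons w i)], exactly what the correction subtracts. *)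
Lemma residual_orth w j b : disk b -> ip (v j * b) (residual w) = 0.
Proof.
move=> hb; have := @disk_functional0 _ (bounded_functional_ip (v j) 1 (residual w)) _ b hb.
rewrite mulr1; apply => {b hb} u; rewrite mulr1.
have shift1 z u' k : disk z -> ip (z * sw (rcons u' k)) 1 = 0.
  move=> hz; rewrite sw_rcons mulrA; apply: ip_right_shift1.
  by apply: diskM => //; exact: disk_sw.
elim/last_ind: w u => [|w i IH] u.
  rewrite residual_nil ipBr ip_v_comb; case/lastP: u => [|u k].
    by rewrite /fcoef sw_nil mulr1 mulr1 subrr.
  by rewrite shift1 // -size_eq0 size_rcons mulr0 subrr.
rewrite residual_rcons ipBr ip_v_comb; case/lastP: u => [|u k]; last first.
  rewrite -size_eq0 size_rcons mulr0 subr0 sw_rcons mulrA ip_right_shift ?IH ?mulr0 //.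
    by apply: diskM => //; exact: disk_sw.
  exact: disk_residual.
rewrite sw_nil !mulr1 /fcoef; have [b [hb hw]] := sw_residual w.
rewrite -[residual w](subKr (sw w)) hw mulrBl ipBr -sw_rcons.
rewrite mulr_suml ip_sumr big1 ?subr0 ?subrr // => k _.
rewrite -mulrA -[v j]mulr1 ip_adj [star _ * _]mulrA v_orth -ip_conj.
case: (j == k); last by rewrite /ip mulr0n mul0r mulr0 phi0 conjC0.
by rewrite mul1r ip_right_shift1 ?conjC0.
Qed.

Lemma range_residual_orth z w : v_range z -> ip z (residual w) = 0.
Proof. by case=> b [hb ->]; rewrite ip_suml big1 // => j _; exact: residual_orth. Qed.

Definition defect w := nr2 (residual w).

Definition fmass w : R := \sum_j cabs (fcoef j w) ^+ 2.

Lemma defect_ge0 w : 0 <= defect w.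
Proof. exact/nr2_ge0/disk_residual. Qed.

Lemma fmass_ge0 w : 0 <= fmass w.
Proof. by apply: sumr_ge0 => j _; exact: sqr_ge0. Qed.

Lemma nr2_v_comb w : nr2 (\sum_j (fcoef j w)^* *: v j) = fmass w.
Proof.
apply: complexI; rewrite -ipxx ip_suml rmorph_sum; apply: eq_bigr => j _ /=.
have := ip_v_comb j [::] (fcoef^~ w); rewrite sw_nil mulr1 => e.
by rewrite ipZl e mulr1 cabs_sqr.
Qed.

Lemma residual_comb_orth w (c : 'I_n -> R[i]) : ip (residual w) (\sum_j c j *: v j) = 0.
Proof.
rewrite -ip_conj ip_suml big1 ?conjC0 // => j _.
by rewrite ipZl -[v j]mulr1 residual_orth ?mulr0 //; exact: disk1.
Qed.

Lemma defect_nil : defect [::] = 1 - fmass [::].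
Proof.
have := nr2_pyth (residual_comb_orth [::] (fun j => (fcoef j [::])^*)).
rewrite {1}residual_nil subrK nr2_v_comb => e; apply/eqP; rewrite eq_sym subr_eq -e.
by rewrite /nr2 -sw_nil ip_words.
Qed.

(** Pythagoras for the correction, as [residual w * s i] has the same vacuum norm as
    [residual w]. *)
Lemma defect_rcons w i : defect (rcons w i) = defect w - fmass (rcons w i).
Proof.
have := nr2_pyth (residual_comb_orth (rcons w i) (fun j => (fcoef j (rcons w i))^*)).
rewrite {1}residual_rcons subrK nr2_v_comb => e.
apply/eqP; rewrite eq_sym subr_eq -e /nr2 ip_right_shift ?eqxx ?mul1r //.
all: exact: disk_residual.
Qed.

Lemma alg_poly_star_sw p : alg_poly s p ->
  exists D, forall w, (D <= size w)%N -> disk (star p * sw w).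
Proof.
move: p; apply: alg_poly_ind_words => [x y [D hD] [E hE]|c x [D hD]|u].
- exists (maxn D E) => w; rewrite geq_max starD mulrDl => /andP[/hD h1 /hE h2].
  exact: diskD.
- by exists D => w /hD h; rewrite starZ -scalerAl; apply: diskZ.
exists (size u) => w uw; rewrite sw_div //; case: (_ == _).
  by rewrite mul1r; exact: disk_sw.
by rewrite mul0r; exact: disk0.
Qed.

(** With polynomials [p j] close to [v j], [E = 1 - sum_j v_j p_j^*] is small because the
    [v_j v_j^*] sum to 1. For a long word each [p_j^* s_w] lies in [disk], so [E * sw w] is
    [residual w] plus an orthogonal element of [v_range], and [defect w] is at most [nrm E ^+ 2]. *)
Lemma defect_small e : 0 < e -> exists D, forall w, (D <= size w)%N -> defect w <= e.
Proof.
move=> e0; have n0 : 0 < n%:R :> R by rewrite ltr0n (leq_ltn_trans _ (ltn_ord i0)).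
pose d := Num.min 1 e; have d0 : 0 < d by rewrite lt_min ltr01.
have d1 : d <= 1 by rewrite ge_min lexx.
have de : d <= e by rewrite ge_min lexx orbT.
have [p hp] := choice (fun j => v_disk j (divr_gt0 d0 n0)).
have [D hD] := choice (fun j => alg_poly_star_sw (hp j).1).
exists (\max_j D j) => w wD.
pose E := 1 - \sum_j v j * star (p j).
have nv j : nrm (v j) = 1 by apply: nrm_isometry; rewrite v_orth eqxx.
have nE : nrm E <= d.
  rewrite /E -v_sum -sumrB; apply: le_trans (nrm_sum _ _ _) _.
  rewrite -[d](divfK (lt0r_neq0 n0)) mulr_natr -[X in _ *+ X]card_ord -sumr_const.
  apply: ler_sum => j _; rewrite -mulrBr -starB; apply: le_trans (nrmM _ _) _.
  by rewrite nv mul1r nrm_star ltW //; case: (hp j).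
have [b [hb hw]] := sw_residual w.
pose m := \sum_j v j * (b j - star (p j) * sw w).
have hm : v_range m.
  exists (fun j => b j - star (p j) * sw w); split=> // j; apply: diskB => //.
  by apply: hD; apply: leq_trans wD; exact: leq_bigmax.
have Ew : E * sw w = residual w + m.
  rewrite /E mulrBl mul1r -{1}(subrK (residual w) (sw w)) hw /m mulr_suml.
  rewrite -addrA addrCA -sumrB; congr (_ + _); apply: eq_bigr => j _.
  by rewrite mulrBr mulrA.
have orth : ip (residual w) m = 0 by rewrite -ip_conj range_residual_orth ?conjC0.
have := nr2_le (E * sw w); rewrite {1}Ew nr2_pyth // -/(defect w).
have := nr2_ge0 (v_range_disk hm).
have : nrm (E * sw w) ^+ 2 <= d * d.
  rewrite expr2; have h : nrm (E * sw w) <= d.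
    by apply: le_trans (nrmM _ _) _; rewrite nrm_sw mulr1.
  by apply: ler_pM; rewrite ?nrm_ge0.
have : d * d <= d by rewrite ler_piMr // ltW.
by lra.
Qed.

(** * Trace of the projection *)

Definition layer m : R := \sum_(w <- words m) defect w.
Definition trace m : R := \sum_(k < m) layer k.
Definition vmass m : R := \sum_(k < m) \sum_(w <- words k) fmass w.

Lemma vmassE m : vmass m = \sum_j energy m (v j).
Proof.
rewrite [RHS]exchange_big; apply: eq_bigr => k _.
by rewrite [RHS]exchange_big.
Qed.

Lemma nr2_v j : nr2 (v j) = 1.
Proof. by rewrite /nr2 /ip v_orth eqxx phi1. Qed.

Lemma vmass_le m : vmass m <= n%:R.
Proof.
rewrite vmassE -[n in leRHS]card_ord -sumr_const; apply: ler_sum => j _.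
by rewrite -(nr2_v j); exact: bessel.
Qed.

Lemma layer0 : layer 0 = 1 - vmass 1.
Proof. by rewrite /layer /vmass big_ord1 !big_words0 defect_nil. Qed.

Lemma layerS m : layer m.+1 = n%:R * layer m - \sum_(w <- words m.+1) fmass w.
Proof.
rewrite /layer !big_wordsS mulr_sumr -sumrB; apply: eq_bigr => w _.
rewrite mulr_natl -[X in _ *+ X]card_ord -sumr_const -sumrB.
by apply: eq_bigr => i _; rewrite defect_rcons.
Qed.

Lemma trace_recr m : trace m.+1 = trace m + layer m.
Proof. by rewrite /trace big_ord_recr. Qed.

(** Every word of length below [m] passes its defect to [n] extensions, diminished by their [fmass];
    the empty word, which extends nothing, contributes [1 - fmass [::]]. *)
Lemma traceS m : trace m.+1 = 1 + n%:R * trace m - vmass m.+1.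
Proof.
elim: m => [|m IH]; first by rewrite /trace big_ord1 big_ord0 mulr0 addr0 layer0.
have -> : vmass m.+2 = vmass m.+1 + \sum_(w <- words m.+1) fmass w.
  by rewrite /vmass big_ord_recr.
by rewrite [LHS]trace_recr {1}IH layerS trace_recr; ring.
Qed.

Lemma n_ge2 : (2 <= n)%N.
Proof.
move: i01; rewrite -val_eqE /=; have := ltn_ord i0; have := ltn_ord i1; lia.
Qed.

(* If [trace m > 1] then [trace] grows like [n^m], against [defect w -> 0]. *)
Lemma trace_le1 m : trace m <= 1.
Proof.
case: leP => // m1; set d := trace m - 1; have d0 : 0 < d by rewrite subr_gt0.
have n2 : 2 <= n%:R :> R by rewrite ler_nat n_ge2.
have grow k : n%:R ^+ k * d <= trace (m + k) - 1.
  elim: k => [|k IH]; first by rewrite expr0 mul1r addn0.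
  rewrite addnS traceS exprS -mulrA.
  have := vmass_le (m + k).+1.
  have : n%:R * (n%:R ^+ k * d) <= n%:R * (trace (m + k) - 1) by apply: ler_wpM2l.
  by lra.
(* A layer is an increment of [trace], at least [(n - 1) * (trace (m + k) - 1)], so single layers
   inherit the growth. *)
have big k : n%:R ^+ k * d <= layer (m + k).
  have := grow k; have := traceS (m + k); rewrite trace_recr.
  have := vmass_le (m + k).+1.
  have nd : 0 <= n%:R ^+ k * d by apply: mulr_ge0; [exact: exprn_ge0 | exact: ltW].
  have : 0 <= (n%:R - 2) * (trace (m + k) - 1).
    by rewrite mulr_ge0 ?subr_ge0 //; have := grow k; lra.
  by lra.
have nm : 0 < n%:R ^+ m :> R by rewrite exprn_gt0 //; lra.
(* Layer [m + D] has [n ^ (m + D)] words, so this bound on each defect caps the layer at half of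
   [n ^ D * d]. *)
have [D hD] := defect_small (divr_gt0 (divr_gt0 d0 nm) (ltr0n _ 2)).
have small : layer (m + D) <= (n ^ (m + D))%:R * (d / n%:R ^+ m / 2).
  rewrite mulr_natl -size_words -sum1_size -sumrMnr /layer.
  rewrite big_seq [leRHS]big_seq; apply: ler_sum => w; rewrite mem_words => /eqP wm.
  by rewrite mulr1n; apply: hD; rewrite wm leq_addl.
have := le_trans (big D) small; rewrite natrX exprD.
have -> : n%:R ^+ m * n%:R ^+ D * (d / n%:R ^+ m / 2) = n%:R ^+ D * d / 2.
  by field; rewrite gt_eqF.
have : 0 < n%:R ^+ D * d by rewrite mulr_gt0 // exprn_gt0 //; lra.
by lra.
Qed.

(** Otherwise the recursion makes every defect vanish and [traceS] pins [vmass] to 1, whereas by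
    Parseval [vmass] approaches [n >= 2]. *)
Lemma defect_nil_gt0 : 0 < defect [::].
Proof.
rewrite lt_neqAle defect_ge0 andbT; apply/eqP => d0.
have defect0 w : defect w = 0.
  elim/last_ind: w => [|w i IH]; first by rewrite -d0.
  apply: le_anti; rewrite defect_ge0 andbT defect_rcons IH sub0r oppr_le0.
  exact: fmass_ge0.
have trace0 m : trace m = 0.
  by rewrite /trace big1 // => k _; rewrite /layer big1.
(* With errors below 1/4 two of the [v j] already carry mass above 3/2. *)
have q0 : 0 < 4^-1 :> R by rewrite invr_gt0.
have [m hm] := parseval (v_disk i0) q0; have [k hk] := parseval (v_disk i1) q0.
have := traceS (maxn m k); rewrite !trace0 vmassE (bigD1 i0) //= (bigD1 i1) 1?eq_sym //=.
have := hm _ (leqW (leq_maxl m k)); have := hk _ (leqW (leq_maxr m k)).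
have : 0 <= \sum_(i < n | (i != i0) && (i != i1)) energy (maxn m k).+1 (v i).
  by apply: sumr_ge0 => j _; exact: energy_ge0.
by rewrite !nr2_v; lra.
Qed.

(* Two orthogonal vectors in the range of the projection would force its trace above 1. *)
Lemma residual_rank1 y : disk y -> (forall z, v_range z -> ip z y = 0) ->
  ip y (residual [::]) = 0 -> nr2 y = 0.
Proof.
move=> hy y_range yg; apply/eqP/negPn/negP => t0.
have tp : 0 < nr2 y by rewrite lt_neqAle eq_sym t0 nr2_ge0.
set g := residual [::] in yg; have kp : 0 < nr2 g := defect_nil_gt0.
have hg : disk g := disk_residual [::].
(* [g] and [y] lie in the range of the projection, so they pair with [sw w] as with its residual;
   Bessel for the residual and two orthogonal vectors gives the bound. *)
have bound w : cabs (ip g (sw w)) ^+ 2 / nr2 g + cabs (ip y (sw w)) ^+ 2 / nr2 y <= defect w.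
  set r := residual w.
  have rE z : (forall x, v_range x -> ip x z = 0) -> ip (sw w) z = ip r z.
    move=> hz; apply/eqP; rewrite -subr_eq0 -ipBl; apply/eqP/hz.
    exact: sw_residual.
  have rg : ip (sw w) g = ip r g by apply: rE => x; exact: range_residual_orth.
  have ry : ip (sw w) y = ip r y by exact: rE.
  rewrite -(ip_conj _ g) -(ip_conj _ y) !cabs_conj rg ry.
  have p1 := nr2_proj r (lt0r_neq0 kp); set x := r - _ in p1.
  have hx : disk x by apply: diskB; [exact: disk_residual | exact: diskZ].
  have xy : ip x y = ip r y by rewrite ipBl ipZl -(ip_conj y g) yg conjC0 mulr0 subr0.
  have := nr2_proj x t0; rewrite p1 xy; set z := x - _ => p2.
  have : 0 <= nr2 z by apply: nr2_ge0; apply: diskB => //; exact: diskZ.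
  by rewrite p2 /defect -/r; lra.
have sum m : energy m g / nr2 g + energy m y / nr2 y <= trace m.
  rewrite !mulr_suml -big_split; apply: ler_sum => k _ /=.
  by rewrite !mulr_suml -big_split; apply: ler_sum => w _; exact: bound.
(* Relative errors of a quarter leave each normalised energy above 3/4, and the sum 3/2 contradicts
   [trace_le1]. *)
have [m hm] := parseval hg (divr_gt0 kp (ltr0n _ 4)).
have [k hk] := parseval hy (divr_gt0 tp (ltr0n _ 4)).
have := hm _ (leq_maxl m k); have := hk _ (leq_maxr m k).
have := sum (maxn m k); have := trace_le1 (maxn m k); set M := maxn m k => h1 h2 h3 h4.
have : 3 / 4 < energy M g / nr2 g by rewrite ltr_pdivlMr //; lra.
have : 3 / 4 < energy M y / nr2 y by rewrite ltr_pdivlMr //; lra.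
by lra.
Qed.

(** Removing from [residual [:: i]] its component along [g] gives a vector to which [residual_rank1]
    applies. That yields only [nr2 = 0]; [nr2_faithful] makes it an equation in [A]. *)
Lemma residual_gen i : exists c, residual [:: i] = c *: residual [::].
Proof.
set g := residual [::]; set r := residual [:: i].
have kp : 0 < nr2 g := defect_nil_gt0.
exists (ip r g / (nr2 g)%:C%C); apply/eqP; rewrite -subr_eq0; apply/eqP; set c := _ / _.
have hy : disk (r - c *: g) by apply: diskB; last apply: diskZ; exact: disk_residual.
apply: nr2_faithful => //; apply: residual_rank1 => // [z hz|].
  by rewrite ipBr ipZr !range_residual_orth // mulr0 subr0.
rewrite ipBl ipZl ipxx divfK ?subrr //.
by apply: contra (lt0r_neq0 kp) => /eqP h; apply/eqP/complexI.
Qed.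

Lemma alg_poly_sum (I J : Type) (t : J -> A) (r : seq I) (P : pred I) (F : I -> A) :
  (forall i, P i -> alg_poly t (F i)) -> alg_poly t (\sum_(i <- r | P i) F i).
Proof.
move=> h; elim/big_ind: _ => //; last exact: ap_add.
by rewrite -(scale0r 1); apply: ap_scale; exact: ap_one.
Qed.

(* [residual [:: i] = g s_i - (a combination of the v_j)] is a multiple of [g = 1 - b], and
   [|b| < 1], so [s_i] is recovered from the [v_j] by a Neumann series for [g^-1]. *)
Lemma gen_approx i e : 0 < e -> exists x, alg_poly v x /\ nrm (s i - x) < e.
Proof.
move=> e0; have [c] := residual_gen i; rewrite (residual_rcons [::] i) residual_nil.
set b := \sum_j _ *: _; set d := \sum_j _ *: _ => rel.
have {}rel : (1 - b) * s i = c *: (1 - b) + d by rewrite -rel subrK.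
have v_comb (t : 'I_n -> R[i]) : alg_poly v (\sum_j t j *: v j).
  by apply: alg_poly_sum => j _; apply: ap_scale; exact: ap_gen.
(* Orthogonality of the [v j] makes [star b * b] scalar, so [nrm b ^+ 2] is [fmass [::] = 1 - defect
   [::]]. *)
have bb : star b * b = ((fmass [::])%:C)%C *: 1.
  rewrite star_sum mulr_suml rmorph_sum scaler_suml; apply: eq_bigr => j _ /=.
  rewrite mulr_sumr (bigD1 j) //= big1 ?addr0 => [|k kj].
    by rewrite starZ conjCK -scalerAl -scalerAr v_orth eqxx scalerA cabs_sqr mulrC.
  by rewrite starZ -scalerAl -scalerAr v_orth eq_sym (negPf kj) !scaler0.
have b1 : nrm b < 1.
  rewrite -(@ltr_pXn2r _ 2) ?nnegrE ?nrm_ge0 ?ler01 // expr1n -nrm_starM bb nrm_scalar.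
  rewrite cabsR ger0_norm ?fmass_ge0 //.
  by have := defect_nil_gt0; rewrite defect_nil subr_gt0.
have [N /(_ N (leqnn N)) bN] := geometric_lt (nrm_ge0 b) b1 e0.
have nX k : nrm (b ^+ k) <= nrm b ^+ k.
  elim: k => [|k IH]; first by rewrite !expr0 nrm1.
  by rewrite !exprS; apply: le_trans (nrmM _ _) _; rewrite ler_wpM2l ?nrm_ge0.
have geo k : (\sum_(l < k) b ^+ l) * (1 - b) = 1 - b ^+ k.
  elim: k => [|k IH]; first by rewrite big_ord0 mul0r expr0 subrr.
  by rewrite big_ord_recr mulrDl IH /= mulrBr mulr1 -exprSr addrA subrK.
have poly_b : alg_poly v b by exact: v_comb.
exists ((\sum_(l < N) b ^+ l) * (c *: (1 - b) + d)); split.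
  apply: ap_mul.
    apply: alg_poly_sum => l _; elim: (l : nat) => [|k IH]; first exact: ap_one.
    by rewrite exprS; exact: ap_mul.
  apply: ap_add; last exact: v_comb.
  by apply: ap_scale; rewrite -scaleN1r; apply: ap_add; [exact: ap_one | exact: ap_scale].
rewrite -rel mulrA geo mulrBl mul1r subKr.
apply: le_lt_trans (nrmM _ _) _; rewrite nrm_gen mulr1.
exact: le_lt_trans (nX N) bN.
Qed.

End DiskIsometries.

(** * Surjectivity of the endomorphism *)

Section DiskPreservingEndo.
Variable alpha : A -> A.
Hypothesis ha : unital_star_endo star alpha.
Hypothesis hdisk : forall x, disk x -> disk (alpha x).

(** [gen_approx] is applied to [v j = alpha (s j)]: a polynomial in these is the image of the same
    polynomial in the [s j]. *)
Lemma gen_in_image i : exists x, disk x /\ alpha x = s i.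
Proof.
apply: (star_endo_closed_image ha) => e e0.
have v_orth k j : star (alpha (s k)) * alpha (s j) = (k == j)%:R.
  rewrite -(endo_star ha) -(endoM ha) gen_orth.
  by case: (k == j); [exact: endo1 ha | exact: endo0 ha].
have v_sum : \sum_j alpha (s j) * star (alpha (s j)) = 1.
  rewrite -(endo1 ha) -s_sum (endo_sum ha); apply: eq_bigr => j _.
  by rewrite (endoM ha) (endo_star ha).
have [x [hx sx]] := gen_approx (fun j => hdisk (disk_gen j)) v_orth v_sum i e0.
suff [y [hy xy]] : exists y, alg_poly s y /\ alpha y = x by exists y; rewrite xy.
elim: hx {sx} => {x} [j||x y _ [p [hp <-]] _ [q [hq <-]]|c x _ [p [hp <-]]
                    |x y _ [p [hp <-]] _ [q [hq <-]]].
- by exists (s j); split=> //; exact: ap_gen.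
- by exists 1; rewrite (endo1 ha); split=> //; exact: ap_one.
- by exists (p + q); rewrite (endoD ha); split=> //; exact: ap_add.
- by exists (c *: p); rewrite (endoZ ha); split=> //; exact: ap_scale.
- by exists (p * q); rewrite (endoM ha); split=> //; exact: ap_mul.
Qed.

Lemma disk_in_image y : disk y -> exists x, disk x /\ alpha x = y.
Proof.
move=> hy; have [x [hx xy]] : exists x, nclosure nrm disk x /\ alpha x = y.
  apply: (star_endo_closed_image ha) => e /hy [p [hp yp]].
  suff [x [hx px]] : exists x, disk x /\ alpha x = p by exists x; rewrite px.
  elim: hp {yp} => {p} [j||p q _ [x [hx <-]] _ [z [hz <-]]|c p _ [x [hx <-]]
                      |p q _ [x [hx <-]] _ [z [hz <-]]].
  - exact: gen_in_image.
  - by exists 1; rewrite (endo1 ha); split=> //; exact: disk1.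
  - by exists (x + z); rewrite (endoD ha); split=> //; exact: diskD.
  - by exists (c *: x); rewrite (endoZ ha); split=> //; exact: diskZ.
  - by exists (x * z); rewrite (endoM ha); split=> //; exact: diskM.
by exists x; split=> //; exact: disk_closed.
Qed.

Lemma endo_surjective y : exists x, alpha x = y.
Proof.
suff [x [_ xy]] : exists x, nclosure nrm (fun=> True) x /\ alpha x = y by exists x.
apply: (star_endo_closed_image ha) => e /(s_dense y) [p [hp yp]].
suff [x px] : exists x, alpha x = p by exists x; rewrite px.
elim: hp {yp} => {p} [j||p q _ [x <-] _ [z <-]|c p _ [x <-]|p q _ [x <-] _ [z <-]|p _ [x <-]].
- by have [x [_ <-]] := gen_in_image j; exists x.
- by exists 1; rewrite (endo1 ha).
- by exists (x + z); rewrite (endoD ha).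
- by exists (c *: x); rewrite (endoZ ha).
- by exists (x * z); rewrite (endoM ha).
- by exists (star x); rewrite (endo_star ha).
Qed.

Lemma endo_bijective : bijective alpha.
Proof.
have [beta hbeta] := choice endo_surjective.
exists beta => // x; apply/eqP; rewrite -subr_eq0; apply/eqP/nrm_eq0.
by rewrite -(star_endo_isometric ha) (endoB ha) hbeta subrr nrm0.
Qed.

End DiskPreservingEndo.

End CuntzRelations.

End CStarFacts.

Theorem theoremT (R : realType) (A : algType R[i]) (n : nat) (hn : (2 <= n)%N)
    (star : A -> A) (nrm : A -> R) (s : 'I_n -> A)
    (hO : is_cuntz_algebra star nrm s)
    (alpha : A -> A) (halpha : unital_star_endo star alpha)
    (hinv : forall x, disk_algebra nrm s x -> disk_algebra nrm s (alpha x)) :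
  star_automorphism star alpha /\
  (forall y, disk_algebra nrm s y <->
     exists x, disk_algebra nrm s x /\ alpha x = y).
Proof.
case: hO => hA s_isom s_sum s_dense.
have i01 : Ordinal (ltnW hn) != Ordinal hn by [].
split; first by split=> //; exact: (endo_bijective hA s_isom s_sum i01 s_dense).
move=> y; split; first exact: (disk_in_image hA s_isom s_sum i01 s_dense).
by case=> x [hx <-]; exact: hinv.
Qed.
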